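(* Let $p$ be a prime, let $d_x,d_y$ be positive integers, let $w$ be a positive integer and let $q\in[1,\infty]$. Then $\mathrm{pReLU}$-networks of width $w$ have the universal approximation property for continuous functions $f:\mathbb Z_p^{d_x}\to\mathbb Q_p^{d_y}$ in the $L_q$ norm if and only if $w\geq\max(d_x+1,d_y)$. Here the universal approximation property means: for every continuous $f:\mathbb Z_p^{d_x}\to\mathbb Q_p^{d_y}$ and every real $\epsilon>0$ there is a $\mathrm{pReLU}$-network $g:\mathbb Q_p^{d_x}\to\mathbb Q_p^{d_y}$ of width $w$ such that $\|f-g|_{\mathbb Z_p^{d_x}}\|_q<\epsilon$.
   Context: $\mathbb Q_p$ denotes the field of $p$-adic numbers, $\mathbb Z_p$ the ring of $p$-adic integers, and $|\cdot|$ the $p$-adic absolute value normalised by $|p|=\frac1p$. On $\mathbb Q_p^n$ use the norm $\|(x_1,\dots,x_n)\|=\max_i|x_i|$. The function $\mathrm{pReLU}:\mathbb Q_p\to\mathbb Q_p$ is defined by $\mathrm{pReLU}(x)=x$ if $x\in\mathbb Z_p$ and $\mathrm{pReLU}(x)=0$ otherwise. A $\mathrm{pReLU}$-network with input dimension $d_x$, output dimension $d_y$ and hidden layer dimensions $d_1,\dots,d_{L-1}$ is a composition $t_L\circ\Sigma_{L-1}\circ t_{L-1}\circ\cdots\circ t_2\circ\Sigma_1\circ t_1:\mathbb Q_p^{d_x}\to\mathbb Q_p^{d_y}$, where (with $d_0=d_x$, $d_L=d_y$) each $t_l:\mathbb Q_p^{d_{l-1}}\to\mathbb Q_p^{d_l}$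 is an affine map with coefficients in $\mathbb Q_p$ and $\Sigma_l:\mathbb Q_p^{d_l}\to\mathbb Q_p^{d_l}$ applies $\mathrm{pReLU}$ to each coordinate. Its width is $\max(d_1,\dots,d_{L-1})$. Let $\mu$ be the Haar measure on $\mathbb Z_p^{n}$ with $\mu(\mathbb Z_p^n)=1$. For continuous $f:\mathbb Z_p^n\to\mathbb Q_p^m$ and $q\in[1,\infty)$, $\|f\|_q=\left(\int_{\mathbb Z_p^n}\|f(x)\|^q\,d\mu(x)\right)^{1/q}$, and $\|f\|_\infty=\sup_{x\in\mathbb Z_p^n}\|f(x)\|$. *)

(* Defs.v *)
From HB Require Import structures.
From mathcomp Require Import all_boot all_order all_algebra.
From mathcomp Require Import generic_quotient ring_quotient.
From mathcomp Require Import all_classical all_reals all_analysis.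
From mathcomp Require Import lra.

Set Implicit Arguments.
Unset Strict Implicit.
Unset Printing Implicit Defensive.
Import Order.TTheory GRing.Theory Num.Theory.
Import numFieldNormedType.Exports.

Local Open Scope classical_set_scope.
Local Open Scope ring_scope.

Section RatAbs.
Variable p : nat.

(* The valuation of x <> 0 is logn p (numerator) - logn p (denominator). *)
Definition rat_padic_abs (x : rat) : rat :=
  if x == 0 then 0
  else p%:R ^ ((logn p `|denq x|)%:Z - (logn p `|numq x|)%:Z).

Lemma rat_padic_abs0 : rat_padic_abs 0 = 0.
Proof. by rewrite /rat_padic_abs eqxx. Qed.

Lemma rat_padic_abs1 : rat_padic_abs 1 = 1.
Proof. by rewrite /rat_padic_abs oner_eq0 -[1]/(1%:~R) denq_int numq_int /= logn1 subrr. Qed.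

Lemma rat_padic_absN x : rat_padic_abs (- x) = rat_padic_abs x.
Proof. by rewrite /rat_padic_abs oppr_eq0 denqN numqN abszN. Qed.

Hypothesis p_pr : prime p.

Let p0 : (0 < p%:R :> rat). Proof. by rewrite ltr0n prime_gt0. Qed.
Let p1 : (1 < p%:R :> rat). Proof. by rewrite ltr1n prime_gt1. Qed.

Lemma rat_padic_abs_ge0 x : 0 <= rat_padic_abs x.
Proof.
by rewrite /rat_padic_abs; case: eqP => // _; rewrite exprz_ge0 // ltW.
Qed.

Lemma rat_padic_abs_eq0 x : (rat_padic_abs x == 0) = (x == 0).
Proof.
rewrite /rat_padic_abs; case: (x =P 0) => [_|_]; first by rewrite eqxx.
by apply/negbTE; rewrite expfz_neq0 // gt_eqF.
Qed.

Lemma rat_padic_abs_frac (a b : int) : a != 0 -> b != 0 ->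
  rat_padic_abs (a%:~R / b%:~R) = p%:R ^ ((logn p `|b|)%:Z - (logn p `|a|)%:Z).
Proof.
move=> a0 b0; have b0' : b%:~R != 0 :> rat by rewrite intr_eq0.
have x0 : a%:~R / b%:~R != 0 :> rat by rewrite mulf_neq0 ?invr_eq0 ?intr_eq0.
rewrite /rat_padic_abs (negbTE x0); set x : rat := _ / _ in x0 *.
have: (numq x * b = a * denq x)%R.
  apply: (@intr_inj rat); rewrite !intrM.
  have d0 : (denq x)%:~R != 0 :> rat by rewrite intr_eq0 denq_neq0.
  apply: (mulIf (x := (b%:~R * (denq x)%:~R)^-1)).
    by rewrite invr_eq0 mulf_neq0.
  have -> : (numq x)%:~R * b%:~R / (b%:~R * (denq x)%:~R)
      = (numq x)%:~R / (denq x)%:~R :> rat.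
    by rewrite invfM mulrA mulfK.
  by rewrite divq_num_den invfM mulrACA divff ?mulr1.
move/(congr1 absz); rewrite !abszM => /(congr1 (logn p)).
rewrite !lognM ?absz_gt0 ?denq_neq0 ?numq_eq0 // => E.
congr (_ ^ _); apply/eqP; rewrite subr_eq addrAC eq_sym subr_eq -!PoszD.
by rewrite eqz_nat addnC E addnC.
Qed.

Lemma rat_padic_absM x y :
  rat_padic_abs (x * y) = rat_padic_abs x * rat_padic_abs y.
Proof.
have [->|x0] := eqVneq x 0; first by rewrite mul0r rat_padic_abs0 mul0r.
have [->|y0] := eqVneq y 0; first by rewrite mulr0 rat_padic_abs0 mulr0.
rewrite -{1}(divq_num_den x) -{1}(divq_num_den y) mulrACA -invfM -!intrM.
rewrite rat_padic_abs_frac ?mulf_neq0 ?denq_neq0 ?numq_eq0 //.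
rewrite /rat_padic_abs (negbTE x0) (negbTE y0) -expfzDr ?gt_eqF //.
rewrite !abszM !lognM ?absz_gt0 ?denq_neq0 ?numq_eq0 // !PoszD opprD.
by congr (_ ^ _); rewrite addrACA.
Qed.

Lemma rat_padic_abs_int (a : int) (k : nat) :
  rat_padic_abs a%:~R <= p%:R ^- k = (p ^ k %| `|a|)%N.
Proof.
have [->|a0] := eqVneq a 0.
  by rewrite rat_padic_abs0 dvdn0 invr_ge0 exprn_ge0 // ltW.
have := rat_padic_abs_frac a0 (oner_neq0 int); rewrite divr1 => ->.
rewrite logn1 sub0r pfactor_dvdn ?absz_gt0 //.
rewrite (_ : p%:R ^- k = p%:R ^ (- k%:Z)); last by rewrite -invr_expz.
by rewrite ler_eXz2l // lerN2.
Qed.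

Lemma rat_padic_abs_ultra x y :
  rat_padic_abs (x + y) <= Num.max (rat_padic_abs x) (rat_padic_abs y).
Proof.
have key (a b : int) : rat_padic_abs (a + b)%:~R <=
    Num.max (rat_padic_abs a%:~R) (rat_padic_abs b%:~R).
  have [->|a0] := eqVneq a 0.
    by rewrite add0r le_max lexx orbT.
  have [->|b0] := eqVneq b 0; first by rewrite addr0 le_max lexx.
  have E (c : int) : c != 0 -> rat_padic_abs c%:~R = p%:R ^- (logn p `|c|).
    move=> c0; have := rat_padic_abs_frac c0 (oner_neq0 int).
    by rewrite divr1 logn1 sub0r -invr_expz.
  wlog le_ab : a b a0 b0 / rat_padic_abs a%:~R <= rat_padic_abs b%:~R.
    move=> W; have [ab|/ltW ba] := leP (rat_padic_abs a%:~R) (rat_padic_abs b%:~R).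
      by apply: le_trans (W _ _ a0 b0 ab) _; rewrite (max_idPr ab).
    by rewrite addrC; apply: le_trans (W _ _ b0 a0 ba) _; rewrite (max_idPr ba).
  rewrite (max_idPr le_ab) (E b) // rat_padic_abs_int.
  have := le_ab; rewrite (E b) // rat_padic_abs_int => da.
  have db : (p ^ logn p `|b| %| `|b|)%N by rewrite pfactor_dvdnn.
  have : ((p ^ logn p `|b|)%:Z %| a + b)%Z by apply: rpredD.
  by [].
have dx := denq_neq0 x; have dy := denq_neq0 y.
have ix : (denq x)%:~R != 0 :> rat by rewrite intr_eq0.
have iy : (denq y)%:~R != 0 :> rat by rewrite intr_eq0.
pose D : rat := (denq x * denq y)%:~R.
have D0 : D != 0 by rewrite intr_eq0 mulf_neq0.
have xD : x * D = (numq x * denq y)%:~R.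
  by rewrite -{1}(divq_num_den x) /D !intrM mulrA mulfVK.
have yD : y * D = (numq y * denq x)%:~R.
  by rewrite -{1}(divq_num_den y) /D !intrM [X in _ * X]mulrC mulrA mulfVK.
have aD : 0 < rat_padic_abs D.
  by rewrite lt_neqAle rat_padic_abs_ge0 eq_sym rat_padic_abs_eq0 D0.
rewrite -(ler_pM2r aD) (maxr_pMl _ _ (ltW aD)) -!rat_padic_absM mulrDl xD yD.
by rewrite -intrD key.
Qed.

Lemma rat_padic_abs_prime : rat_padic_abs p%:R = p%:R^-1.
Proof.
have pn0 : p%:Z != 0 by rewrite eqz_nat -lt0n prime_gt0.
have := rat_padic_abs_frac pn0 (oner_neq0 int).
by rewrite divr1 logn1 sub0r /= logn_prime // eqxx => ->.
Qed.

Lemma rat_padic_absV x : rat_padic_abs x^-1 = (rat_padic_abs x)^-1.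
Proof.
have [->|x0] := eqVneq x 0; first by rewrite !(invr0, rat_padic_abs0).
have ax0 : rat_padic_abs x != 0 by rewrite rat_padic_abs_eq0.
by apply: (mulIf ax0); rewrite -rat_padic_absM !mulVf // rat_padic_abs1.
Qed.

Lemma rat_padic_absD x y :
  rat_padic_abs (x + y) <= rat_padic_abs x + rat_padic_abs y.
Proof.
apply: le_trans (rat_padic_abs_ultra x y) _.
by rewrite ge_max lerDl lerDr !rat_padic_abs_ge0.
Qed.

Lemma rat_padic_abs_dist x y :
  `|rat_padic_abs x - rat_padic_abs y| <= rat_padic_abs (x - y).
Proof.
rewrite ler_norml; apply/andP; split; last first.
  by rewrite lerBlDr -{1}(subrK y x) rat_padic_absD.
rewrite lerNl opprB lerBlDr -{1}(subrK x y) -[rat_padic_abs (x - y)]rat_padic_absN.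
by rewrite opprB rat_padic_absD.
Qed.

End RatAbs.

(* Q_p is the completion of rat for rat_padic_abs: the ring of Cauchy
   sequences modulo the ideal of null sequences.  The proof that p is prime is
   an argument of these definitions, so that the instances below can find it. *)

Definition padic_cauchy (p : nat) (p_pr : prime p) : {pred nat -> rat} :=
  fun u => `[< forall e : rat, 0 < e -> exists N : nat, forall m n,
    (N <= m)%N -> (N <= n)%N -> rat_padic_abs p (u m - u n) < e >].

Section CauchyRing.
Variables (p : nat) (p_pr : prime p).
Local Notation abs := (rat_padic_abs p).

Lemma padic_cauchy_bounded u : u \in padic_cauchy p_pr ->
  exists2 M, 0 < M & forall n, abs (u n) < M.
Proof.
move=> /asboolP /(_ 1 ltr01) [N uN].
pose M := \sum_(i < N.+1) abs (u i).
have M0 : 0 <= M by apply: sumr_ge0 => i _; apply: rat_padic_abs_ge0.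
have uM n : (n <= N)%N -> abs (u n) <= M.
  rewrite -ltnS => nN; rewrite /M (bigD1 (Ordinal nN)) //= lerDl.
  by apply: sumr_ge0 => i _; apply: rat_padic_abs_ge0.
exists (M + 1) => [|n]; first by rewrite ltr_wpDl.
have [/uM nM|/ltnW nN] := leqP n N; first by rewrite ltr_pwDr.
rewrite -(subrK (u N) (u n)); apply: le_lt_trans (rat_padic_absD p_pr _ _) _.
by rewrite addrC ler_ltD // ?uM // uN.
Qed.

Lemma padic_cauchy_subring : subring_closed (padic_cauchy p_pr).
Proof.
split=> [|u v /asboolP cu /asboolP cv|u v cu cv].
- apply/asboolP => e e0; exists 0%N => m n _ _.
  by rewrite /GRing.one /= subrr rat_padic_abs0.
- apply/asboolP => e e0.
  have [N uN] := cu _ e0; have [K vK] := cv _ e0.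
  exists (maxn N K) => m n; rewrite !geq_max => /andP[Nm Km] /andP[Nn Kn].
  rewrite -[(u - v) m]/(u m - v m) -[(u - v) n]/(u n - v n).
  rewrite opprB addrACA (addrC (- v m)) -addrACA addrA -addrA.
  rewrite (_ : _ + _ = (u m - u n) + (v n - v m)); last by lra.
  apply: le_lt_trans (rat_padic_abs_ultra p_pr _ _) _.
  by rewrite gt_max uN // vK.
- have [A A0 uA] := padic_cauchy_bounded cu.
  have [B B0 vB] := padic_cauchy_bounded cv.
  move: cu cv => /asboolP cu /asboolP cv; apply/asboolP => e e0.
  have [N uN] := cu _ (divr_gt0 e0 B0); have [K vK] := cv _ (divr_gt0 e0 A0).
  exists (maxn N K) => m n; rewrite !geq_max => /andP[Nm Km] /andP[Nn Kn].
  rewrite -[(u * v) m]/(u m * v m) -[(u * v) n]/(u n * v n).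
  rewrite (_ : _ - _ = (u m - u n) * v m + u n * (v m - v n)); last by lra.
  apply: le_lt_trans (rat_padic_abs_ultra p_pr _ _) _.
  rewrite !rat_padic_absM // gt_max; apply/andP; split.
    rewrite -[ltRHS](divfK (lt0r_neq0 B0)).
    by apply: ltr_pM => //; rewrite ?rat_padic_abs_ge0 ?uN.
  rewrite -[ltRHS](divfK (lt0r_neq0 A0)) mulrC.
  by apply: ltr_pM => //; rewrite ?rat_padic_abs_ge0 ?vK.
Qed.

HB.instance Definition _ :=
  GRing.isSubringClosed.Build _ (padic_cauchy p_pr) padic_cauchy_subring.

Record padic_seq := PadicSeq {
  padic_seq_val :> nat -> rat;
  padic_seqP : padic_seq_val \in padic_cauchy p_pr
}.

HB.instance Definition _ := [isSub for padic_seq_val].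
HB.instance Definition _ := gen_eqMixin padic_seq.
HB.instance Definition _ := gen_choiceMixin padic_seq.
HB.instance Definition _ := [SubChoice_isSubComNzRing of padic_seq by <:].

Definition padic_null : {pred padic_seq} :=
  fun u => `[< forall e : rat, 0 < e -> exists N : nat, forall n,
    (N <= n)%N -> abs (u n) < e >].

Lemma padic_null_ideal : idealr_closed padic_null.
Proof.
split=> [||a u v /asboolP u0 /asboolP v0].
- by apply/asboolP => e e0; exists 0%N => n _; rewrite /= rat_padic_abs0.
- apply/asboolP => /(_ 1 ltr01) [N /(_ N (leqnn N))].
  by rewrite -[X in abs X]/(1 : rat) rat_padic_abs1 ltxx.
- have [A A0 aA] := padic_cauchy_bounded (padic_seqP a).
  apply/asboolP => e e0.
  have [N uN] := u0 _ (divr_gt0 e0 A0); have [K vK] := v0 _ e0.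
  exists (maxn N K) => n; rewrite geq_max => /andP[Nn Kn].
  rewrite -[X in abs X]/(a n * u n + v n).
  apply: le_lt_trans (rat_padic_abs_ultra p_pr _ _) _.
  rewrite gt_max vK // andbT rat_padic_absM // -[ltRHS](divfK (lt0r_neq0 A0)) mulrC.
  by apply: ltr_pM => //; rewrite ?rat_padic_abs_ge0 ?uN.
Qed.

HB.instance Definition _ :=
  isIdealr.Build padic_seq padic_null padic_null_ideal.

Lemma padic_nonnull_away (u : padic_seq) : u \notin padic_null ->
  exists2 c, 0 < c & exists N : nat, forall n, (N <= n)%N -> c <= abs (u n).
Proof.
move/asboolPn/existsNP => [e /not_implyP [e0 /forallNP ue]].
have /asboolP cu := padic_seqP u; have [N uN] := cu _ e0.
exists e => //; exists N => n Nn.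
have /existsNP [m /not_implyP [Nm /negP]] := ue N; rewrite -leNgt => eum.
rewrite leNgt; apply/negP => une.
have: abs (u m) < e.
  rewrite -(subrK (u n) (u m)); apply: le_lt_trans (rat_padic_abs_ultra p_pr _ _) _.
  by rewrite gt_max uN.
by rewrite ltNge eum.
Qed.

Lemma padic_seq_inv_subproof (u : padic_seq) :
  (if u \in padic_null then cst 0 else fun n => (u n)^-1) \in padic_cauchy p_pr.
Proof.
case: ifPn => [_|/padic_nonnull_away[c c0 [N uN]]]; first exact: rpred0.
have /asboolP cu := padic_seqP u; apply/asboolP => e e0.
have [K uK] := cu _ (mulr_gt0 e0 (mulr_gt0 c0 c0)).
exists (maxn N K) => m n; rewrite !geq_max => /andP[Nm Km] /andP[Nn Kn].
have nz k : (N <= k)%N -> u k != 0.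
  by move=> /uN; rewrite -(rat_padic_abs_eq0 p_pr) => /(lt_le_trans c0)/lt0r_neq0.
rewrite (_ : _ - _ = (u n - u m) * ((u m)^-1 * (u n)^-1)); last first.
  by rewrite mulrBl [in RHS]mulrCA divff ?nz // mulr1 mulrA divff ?nz // mul1r.
rewrite !rat_padic_absM // !rat_padic_absV // -invfM.
have P : 0 < c * c by rewrite mulr_gt0.
have Q : c * c <= abs (u m) * abs (u n) by rewrite ler_pM ?uN // ltW.
rewrite ltr_pdivrMr; last exact: lt_le_trans Q.
by apply: lt_le_trans (uK _ _ Kn Km) _; rewrite ler_pM2l.
Qed.

Definition padic_seq_inv (u : padic_seq) := PadicSeq (padic_seq_inv_subproof u).

(* The absolute value of the class of u is lim_n |u n|_p. *)
Definition padic_seq_abs (u : padic_seq) : rat :=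
  xget 0 [set c : rat | forall e : rat, 0 < e -> exists N : nat, forall n,
    (N <= n)%N -> `|abs (u n) - c| < e].

Lemma padic_seq_abs_unique (u : padic_seq) (c : rat) :
  (forall e : rat, 0 < e -> exists N : nat, forall n,
    (N <= n)%N -> `|abs (u n) - c| < e) -> padic_seq_abs u = c.
Proof.
move=> uc; rewrite /padic_seq_abs.
case: xgetP => [d _ ud|/(_ c)/(_ uc) //].
apply/eqP; rewrite -subr_eq0 -normr_le0 leNgt; apply/negP => dc.
have e0 : 0 < `|d - c| / 2 by rewrite divr_gt0.
have [N uN] := uc _ e0; have [K uK] := ud _ e0.
have := uN _ (leq_maxl N K); have := uK _ (leq_maxr N K).
set a := abs _ => aK aN; have := ler_normB (a - c) (a - d).
rewrite opprB [X in `|X| <= _](_ : _ = d - c); last by lra.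
lra.
Qed.

Lemma padic_seq_abs_eventually (u : padic_seq) (c : rat) :
  (exists N : nat, forall n, (N <= n)%N -> abs (u n) = c) -> padic_seq_abs u = c.
Proof.
move=> [N uN]; apply: padic_seq_abs_unique => e e0; exists N => n /uN ->.
by rewrite subrr normr0.
Qed.

Lemma padic_seq_abs0 (u : padic_seq) : u \in padic_null -> padic_seq_abs u = 0.
Proof.
move=> /asboolP u0; apply: padic_seq_abs_unique => e /u0[N uN]; exists N => n /uN.
by rewrite subr0 ger0_norm // rat_padic_abs_ge0.
Qed.

Lemma padic_seq_abs_const (u : padic_seq) : u \notin padic_null ->
  0 < padic_seq_abs u /\
  exists N : nat, forall n, (N <= n)%N -> abs (u n) = padic_seq_abs u.
Proof.
move=> /padic_nonnull_away [c c0 [N uN]].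
have /asboolP cu := padic_seqP u; have [K uK] := cu _ c0.
pose M := maxn N K.
have E n : (M <= n)%N -> abs (u n) = abs (u M).
  have H m k : (M <= m)%N -> (M <= k)%N -> abs (u m) <= abs (u k).
    rewrite !geq_max => /andP[Nm Km] /andP[Nk Kk].
    rewrite -{1}(subrK (u k) (u m)).
    apply: le_trans (rat_padic_abs_ultra p_pr _ _) _.
    rewrite ge_max lexx andbT; apply/ltW/(lt_le_trans (uK _ _ Km Kk)).
    exact: uN.
  by move=> Mn; apply/eqP; rewrite eq_le !H.
have A : padic_seq_abs u = abs (u M) by apply: padic_seq_abs_eventually; exists M.
split; last by exists M => n /E ->.
by rewrite A (lt_le_trans c0) // uN // leq_maxl.
Qed.

Lemma padic_seq_abs_eq0 (u : padic_seq) :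
  (padic_seq_abs u == 0) = (u \in padic_null).
Proof.
have [/padic_seq_abs0 ->|/padic_seq_abs_const[/lt0r_neq0/negbTE //]] := boolP (u \in _).
by rewrite eqxx.
Qed.

Lemma padic_seq_absM (u v : padic_seq) :
  padic_seq_abs (u * v) = padic_seq_abs u * padic_seq_abs v.
Proof.
have [u0|u0] := boolP (u \in padic_null).
  by rewrite (padic_seq_abs0 u0) mul0r padic_seq_abs0 // mulrC idealMr.
have [v0|v0] := boolP (v \in padic_null).
  by rewrite (padic_seq_abs0 v0) mulr0 padic_seq_abs0 // idealMr.
have [_ [N uN]] := padic_seq_abs_const u0.
have [_ [K vK]] := padic_seq_abs_const v0.
apply: padic_seq_abs_eventually; exists (maxn N K) => n.
rewrite geq_max => /andP[Nn Kn].
by rewrite -[X in abs X]/(u n * v n) rat_padic_absM // uN // vK.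
Qed.

Lemma padic_seq_absN (u : padic_seq) : padic_seq_abs (- u) = padic_seq_abs u.
Proof.
have [u0|u0] := boolP (u \in padic_null).
  by rewrite !padic_seq_abs0 // rpredN.
have [_ [N uN]] := padic_seq_abs_const u0.
apply: padic_seq_abs_eventually; exists N => n /uN <-.
by rewrite -[X in abs X]/(- u n) rat_padic_absN.
Qed.

Lemma padic_seq_abs_null (u v : padic_seq) : v \in padic_null ->
  padic_seq_abs (u + v) = padic_seq_abs u.
Proof.
move=> v0; have [u0|u0] := boolP (u \in padic_null).
  by rewrite !padic_seq_abs0 // rpredD.
have [c0 [N uN]] := padic_seq_abs_const u0.
apply: padic_seq_abs_unique => e e0.
have /asboolP/(_ _ e0) [K vK] := v0.
exists (maxn N K) => n; rewrite geq_max => /andP[/uN <- /vK ve].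
rewrite -[(u + v) n]/(u n + v n).
by rewrite (le_lt_trans (rat_padic_abs_dist p_pr _ _)) // addrC addKr.
Qed.

Lemma padic_seq_abs_ge0 (u : padic_seq) : 0 <= padic_seq_abs u.
Proof.
have [/padic_seq_abs0 -> //|/padic_seq_abs_const[/ltW //]] := boolP (u \in padic_null).
Qed.

Lemma padic_seq_abs_ultra (u v : padic_seq) :
  padic_seq_abs (u + v) <= Num.max (padic_seq_abs u) (padic_seq_abs v).
Proof.
have [u0|u0] := boolP (u \in padic_null).
  by rewrite addrC padic_seq_abs_null // le_max lexx orbT.
have [v0|v0] := boolP (v \in padic_null).
  by rewrite padic_seq_abs_null // le_max lexx.
have [w0|w0] := boolP (u + v \in padic_null).
  by rewrite (padic_seq_abs0 w0) le_max padic_seq_abs_ge0.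
have [_ [N uN]] := padic_seq_abs_const u0.
have [_ [K vK]] := padic_seq_abs_const v0.
have [_ [L wL]] := padic_seq_abs_const w0.
pose n := maxn (maxn N K) L.
have Nn : (N <= n)%N by rewrite !leq_max leqnn.
have Kn : (K <= n)%N by rewrite !leq_max leqnn orbT.
rewrite -(uN n) // -(vK n) // -(wL n) ?leq_maxr //.
exact: rat_padic_abs_ultra.
Qed.

End CauchyRing.

Definition padic (p : nat) (p_pr : prime p) : Type :=
  {ideal_quot (@padic_null p p_pr)}.

Section Padic.
Variables (p : nat) (p_pr : prime p).
Local Notation Qp := (padic p_pr).
Local Open Scope quotient_scope.

HB.instance Definition _ := GRing.ComNzRing.on Qp.
HB.instance Definition _ := isPointed.Build Qp 0.

Definition padic_abs (x : Qp) : rat := padic_seq_abs (repr x).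

Lemma padic_abs_pi (u : padic_seq p_pr) :
  padic_abs (\pi_Qp u) = padic_seq_abs u.
Proof.
rewrite /padic_abs; case: piP => v /eqP; rewrite -Quotient.idealrBE => uv.
by rewrite -(padic_seq_abs_null v uv) addrC subrK.
Qed.

Lemma padic_pi0 (u : padic_seq p_pr) : (\pi_Qp u == 0) = (u \in @padic_null p p_pr).
Proof. by rewrite -[0](rmorph0 (\pi_Qp)) -Quotient.idealrBE subr0. Qed.

Lemma padic_abs_eq0 (x : Qp) : (padic_abs x == 0) = (x == 0).
Proof. by elim/quotW: x => u; rewrite padic_abs_pi padic_seq_abs_eq0 padic_pi0. Qed.

Lemma padic_abs_ge0 (x : Qp) : 0 <= padic_abs x.
Proof. exact: padic_seq_abs_ge0. Qed.

Lemma padic_absM (x y : Qp) : padic_abs (x * y) = padic_abs x * padic_abs y.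
Proof.
elim/quotW: x => u; elim/quotW: y => v.
by rewrite -[_ * _](rmorphM (\pi_Qp)) !padic_abs_pi padic_seq_absM.
Qed.

Lemma padic_absN (x : Qp) : padic_abs (- x) = padic_abs x.
Proof.
by elim/quotW: x => u; rewrite -(rmorphN (\pi_Qp)) !padic_abs_pi padic_seq_absN.
Qed.

Lemma padic_abs_ultra (x y : Qp) :
  padic_abs (x + y) <= Num.max (padic_abs x) (padic_abs y).
Proof.
elim/quotW: x => u; elim/quotW: y => v.
by rewrite -(rmorphD (\pi_Qp)) !padic_abs_pi padic_seq_abs_ultra.
Qed.

Lemma padic_abs1 : padic_abs 1 = 1.
Proof.
rewrite -[1 in LHS](rmorph1 (\pi_Qp)) padic_abs_pi.
apply: padic_seq_abs_eventually; exists 0%N => n _; exact: rat_padic_abs1.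
Qed.

Lemma padic_abs_prime : padic_abs p%:R = p%:R^-1.
Proof.
rewrite -[p%:R in LHS](rmorph_nat (\pi_Qp)) padic_abs_pi.
apply: padic_seq_abs_eventually; exists 0%N => n _.
have E k : (k%:R : padic_seq p_pr) n = k%:R by elim: k => // k IH; rewrite !mulrS -IH.
by rewrite E rat_padic_abs_prime.
Qed.

Definition padic_inv (x : Qp) : Qp := \pi_Qp (padic_seq_inv (repr x)).

Lemma padic_mulVf (x : Qp) : x != 0 -> padic_inv x * x = 1.
Proof.
move=> x0; rewrite /padic_inv -{2}(reprK x) -(rmorphM (\pi_Qp)).
rewrite -[RHS](rmorph1 (\pi_Qp)); apply/eqP; rewrite -Quotient.idealrBE.
have r0 : repr x \notin @padic_null p p_pr by rewrite -padic_pi0 reprK.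
have [c c0 [N rN]] := padic_nonnull_away r0.
apply/asboolP => e e0; exists N => n Nn.
have nz : repr x n != 0.
  by rewrite -(rat_padic_abs_eq0 p_pr) gt_eqF // (lt_le_trans c0) // rN.
rewrite (_ : padic_seq_val _ n = 0) ?rat_padic_abs0 //.
rewrite -[LHS]/(padic_seq_inv (repr x) n * repr x n - 1) /= (negbTE r0).
by rewrite mulVf // subrr.
Qed.

Lemma padic_inv0 : padic_inv 0 = 0.
Proof.
have r0 : repr (0 : Qp) \in @padic_null p p_pr by rewrite -padic_pi0 reprK.
apply/eqP; rewrite padic_pi0; apply/asboolP => e e0; exists 0%N => n _ /=.
by rewrite r0 rat_padic_abs0.
Qed.

HB.instance Definition _ :=
  GRing.ComNzRing_isField.Build Qp padic_mulVf padic_inv0.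

Lemma padic_distxx (x : Qp) : padic_abs (x - x) = 0.
Proof. by apply/eqP; rewrite subrr padic_abs_eq0. Qed.

Lemma padic_dist_pos (x y : Qp) : padic_abs (x - y) = 0 -> x = y.
Proof. by move/eqP; rewrite padic_abs_eq0 subr_eq0 => /eqP. Qed.

Lemma padic_dist_sym (x y : Qp) : padic_abs (x - y) = padic_abs (y - x).
Proof. by rewrite -padic_absN opprB. Qed.

Lemma padic_dist_triangle (y x z : Qp) :
  padic_abs (x - z) <= padic_abs (x - y) + padic_abs (y - z).
Proof.
rewrite -(subrK y x) -addrA; apply: le_trans (padic_abs_ultra _ _) _.
by rewrite subrK ge_max lerDl lerDr !padic_abs_ge0.
Qed.

(* All values of the absolute value are rational, so the metric is rat-valued. *)
HB.instance Definition _ := isMetric.Build rat Qp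
  padic_distxx padic_dist_pos padic_dist_sym padic_dist_triangle.

Definition is_padic_int : {pred Qp} := fun x => padic_abs x <= 1.

Lemma is_padic_int_subring : subring_closed is_padic_int.
Proof.
split=> [|x y x1 y1|x y x1 y1]; rewrite /in_mem /= /is_padic_int.
- by rewrite padic_abs1.
- by apply: le_trans (padic_abs_ultra _ _) _; rewrite padic_absN ge_max; apply/andP.
- by rewrite padic_absM mulr_ile1 // padic_abs_ge0.
Qed.

HB.instance Definition _ :=
  GRing.isSubringClosed.Build Qp is_padic_int is_padic_int_subring.

Record padic_int := PadicInt {
  padic_int_val :> Qp;
  padic_intP : padic_int_val \in is_padic_int
}.

HB.instance Definition _ := [isSub for padic_int_val].
HB.instance Definition _ := [Choice of padic_int by <:].
HB.instance Definition _ := [SubChoice_isSubComNzRing of padic_int by <:].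
HB.instance Definition _ := isPointed.Build padic_int 0.

Lemma padic_int_dist_pos (x y : padic_int) :
  padic_abs (padic_int_val x - padic_int_val y) = 0 -> x = y.
Proof. by move=> /padic_dist_pos /val_inj. Qed.

HB.instance Definition _ := @isMetric.Build rat padic_int
  (fun x y => padic_abs (padic_int_val x - padic_int_val y))
  (fun x => padic_distxx x) padic_int_dist_pos
  (fun x y => padic_dist_sym x y) (fun y x z => padic_dist_triangle y x z).

Definition padic_norm (n : nat) (x : 'cV[Qp]_n) : rat :=
  \big[Num.max/0]_(i < n) padic_abs (x i 0).

Definition pReLU (x : Qp) : Qp := if x \in is_padic_int then x else 0.

(* Feed-forward networks from Qp^m to Qp^dy; the input dimension is an index
   since it varies along the layers. *)
Inductive network (dy : nat) : nat -> Type :=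
| Output m of 'M[Qp]_(dy, m) & 'cV[Qp]_dy : network dy m
| Hidden m d of 'M[Qp]_(d, m) & 'cV[Qp]_d & network dy d : network dy m.

Fixpoint network_eval dy m (N : network dy m) : 'cV[Qp]_m -> 'cV[Qp]_dy :=
  match N in network _ m return 'cV[Qp]_m -> 'cV[Qp]_dy with
  | Output _ A b => fun x => A *m x + b
  | Hidden _ _ A b N' => fun x => network_eval N' (map_mx pReLU (A *m x + b))
  end.

Fixpoint hidden_dims dy m (N : network dy m) : seq nat :=
  match N with
  | Output _ _ _ => [::]
  | Hidden _ d _ _ N' => d :: hidden_dims N'
  end.

(* A network without hidden layer has width 0. *)
Definition network_width dy m (N : network dy m) : nat :=
  \max_(d <- hidden_dims N) d.

Definition Zpn (n : nat) :=
  g_sigma_algebraType (open : set (set 'cV[padic_int]_n)).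

HB.instance Definition _ n := Measurable.on (Zpn n).

(* The normalisation mu setT = 1 is part of the type of mu. *)
Definition is_haar (R : realType) n (mu : probability (Zpn n) R) : Prop :=
  forall (a : 'cV[padic_int]_n) (A : set (Zpn n)),
    measurable A -> mu [set a + x | x in A] = mu A.

(* Lnorm at +oo is an essential supremum, hence the separate case. *)
Definition Lq_norm (R : realType) n m (mu : probability (Zpn n) R)
    (q : \bar R) (f : 'cV[padic_int]_n -> 'cV[Qp]_m) : \bar R :=
  let F x : \bar R := (ratr (padic_norm (f x)))%:E in
  if q == +oo%E then ereal_sup (range F) else Lnorm mu q F.

Definition universal_approximation (R : realType) dx dy
    (mu : probability (Zpn dx) R) (w : nat) (q : \bar R) : Prop :=
  forall (f : 'cV[padic_int]_dx -> 'cV[Qp]_dy) (eps : R),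
    continuous f -> 0 < eps ->
    exists2 N : network dy dx, network_width N = w &
      (Lq_norm mu q
        (fun x => f x - network_eval N (map_mx padic_int_val x))%R < eps%:E)%E.

End Padic.

(* Main.v *)
(* Width [w >= max(dx + 1, dy)] suffices: a continuous map on the compact space
   [Z_p^dx] is, up to an arbitrarily small error, a function of the residues of
   the coordinates modulo [p ^ k].  With one spare neuron each coordinate can be
   rounded to its residue, one residue class at a time; the residues are then
   encoded in a single natural number, and with two neurons the values [j] of
   this code are moved to points of absolute values [p ^ (B + j + 1)].  The
   points with these distinct absolute values can be sent one at a time, the
   largest first, to arbitrary targets in [Q_p^dy] without any spare neuron.

   Conversely, let [f] be locally constant with values of distinct, large absolute
   values on the classes modulo [p ^ k], and let [g] be a network of smaller
   width.  If [w < dy] the image of [g] lies in a proper affine subspace; if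
   [w <= dx] then either [g] is affine on [Z_p^dx], or, at the first layer which
   is not injective on [Z_p^dx], [g] is invariant under a long translation on a
   set one of whose two translates contains any given point.  In each case, a
   bounded number of translates of [{x | 1 <= |f x - g x|}] covers [Z_p^dx], so
   that the Haar measure of this set is bounded below. *)

Require Import Defs.
From HB Require Import structures.
From mathcomp Require Import all_boot all_order all_algebra.
From mathcomp Require Import generic_quotient ring_quotient.
From mathcomp Require Import all_classical all_reals all_analysis.
From mathcomp Require Import ring zify.

Set Implicit Arguments.
Unset Strict Implicit.
Unset Printing Implicit Defensive.
Import Order.TTheory GRing.Theory Num.Theory.
Import numFieldNormedType.Exports.

Local Open Scope classical_set_scope.
Local Open Scope ring_scope.

(** * Absolute values and digits *)

Section PadicAbs.
Variables (p : nat) (p_pr : prime p).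
Local Notation Qp := (padic p_pr).
Local Notation Zp := (padic_int p_pr).
Local Notation abs := (@padic_abs p p_pr).
Local Open Scope quotient_scope.

Lemma prime_gt0_rat : 0 < p%:R :> rat. Proof. by rewrite ltr0n prime_gt0. Qed.
Lemma prime_gt1_rat : 1 < p%:R :> rat. Proof. by rewrite ltr1n prime_gt1. Qed.
Hint Resolve prime_gt0_rat prime_gt1_rat : core.

Lemma prime_exp_gt0 k : 0 < p%:R ^- k :> rat.
Proof. by rewrite invr_gt0 exprn_gt0. Qed.
Hint Resolve prime_exp_gt0 : core.

Lemma prime_exp_le j k : (j <= k)%N -> p%:R ^- k <= p%:R ^- j :> rat.
Proof. by move=> jk; rewrite lef_pV2 ?posrE ?exprn_gt0 // ler_eXn2l. Qed.

Lemma prime_exp_le1 k : p%:R ^- k <= 1 :> rat.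
Proof. by rewrite invf_le1 ?exprn_gt0 // exprn_ege1 // ltW. Qed.

Lemma prime_exp_bound (e : rat) : exists B, e <= p%:R ^+ B.
Proof.
exists (Num.bound e); have [e0|e0] := leP e 0; first
  by apply: le_trans e0 _; rewrite exprn_ge0 // ltW.
apply/ltW/(lt_trans (archi_boundP (ltW e0))).
by rewrite -natrX ltr_nat ltn_expl // prime_gt1.
Qed.

Lemma prime_exp_small (e : rat) : 0 < e -> exists k, p%:R ^- k < e.
Proof.
move=> e0; have [B hB] := prime_exp_bound (e^-1); exists B.+1.
rewrite -[ltRHS]invrK ltf_pV2 ?posrE ?invr_gt0 ?exprn_gt0 //.
by apply: le_lt_trans hB _; rewrite ltr_eXn2l.
Qed.

Lemma padic_abs0 : abs 0 = 0.
Proof. by apply/eqP; rewrite padic_abs_eq0. Qed.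

Lemma padic_absX (x : Qp) k : abs (x ^+ k) = abs x ^+ k.
Proof. by elim: k => [|k IH]; rewrite ?expr0 ?padic_abs1 // !exprS padic_absM IH. Qed.

Lemma padic_absV (x : Qp) : abs x^-1 = (abs x)^-1.
Proof.
have [->|x0] := eqVneq x 0; first by rewrite !(invr0, padic_abs0).
have ax0 : abs x != 0 by rewrite padic_abs_eq0.
by apply: (mulIf ax0); rewrite -padic_absM !mulVf // padic_abs1.
Qed.

Lemma padic_prime_neq0 : p%:R != 0 :> Qp.
Proof. by rewrite -padic_abs_eq0 padic_abs_prime invr_eq0 gt_eqF. Qed.

Lemma padic_primeX_neq0 k : p%:R ^+ k != 0 :> Qp.
Proof. by rewrite expf_neq0 // padic_prime_neq0. Qed.

Lemma padic_abs_primeX k : abs (p%:R ^+ k) = p%:R ^- k.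
Proof. by rewrite padic_absX padic_abs_prime exprVn. Qed.

Lemma padic_abs_primeXV k : abs (p%:R ^- k) = p%:R ^+ k.
Proof. by rewrite padic_absV padic_abs_primeX invrK. Qed.

Lemma padic_absD_le (e : rat) (x y : Qp) : abs x <= e -> abs y <= e -> abs (x + y) <= e.
Proof. by move=> xe ye; apply: le_trans (padic_abs_ultra _ _) _; rewrite ge_max xe. Qed.

Lemma padic_absB_le (e : rat) (x y : Qp) : abs x <= e -> abs y <= e -> abs (x - y) <= e.
Proof. by move=> xe ye; apply: padic_absD_le => //; rewrite padic_absN. Qed.

Lemma padic_absD_lt (e : rat) (x y : Qp) : abs x < e -> abs y < e -> abs (x + y) < e.
Proof. by move=> xe ye; apply: le_lt_trans (padic_abs_ultra _ _) _; rewrite gt_max xe. Qed.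

Lemma padic_absB_lt (e : rat) (x y : Qp) : abs x < e -> abs y < e -> abs (x - y) < e.
Proof. by move=> xe ye; apply: padic_absD_lt => //; rewrite padic_absN. Qed.

Lemma padic_abs_sum_le (e : rat) I (r : seq I) (P : pred I) (F : I -> Qp) : 0 <= e ->
  (forall i, P i -> abs (F i) <= e) -> abs (\sum_(i <- r | P i) F i) <= e.
Proof.
move=> e0 Fe; elim/big_rec: _ => [|i y Pi ye]; first by rewrite padic_abs0.
by apply: padic_absD_le => //; exact: Fe.
Qed.

Lemma padic_abs_sum_lt (e : rat) I (r : seq I) (P : pred I) (F : I -> Qp) : 0 < e ->
  (forall i, P i -> abs (F i) < e) -> abs (\sum_(i <- r | P i) F i) < e.
Proof.
move=> e0 Fe; elim/big_rec: _ => [|i y Pi ye]; first by rewrite padic_abs0.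
by apply: padic_absD_lt => //; exact: Fe.
Qed.

(** If [x + y] were smaller than [x], then [x = (x + y) - y] would be a difference of two elements
    smaller than [x]. *)
Lemma padic_abs_dominant (x y : Qp) : abs y < abs x -> abs (x + y) = abs x.
Proof.
move=> yx; apply/eqP; rewrite eq_le padic_absD_le ?(ltW yx) //=.
rewrite leNgt; apply/negP => xyx.
have := padic_absB_lt xyx yx; by rewrite addrK ltxx.
Qed.

Lemma padic_seq_nat (a n : nat) : (a%:R : padic_seq p_pr) n = a%:R.
Proof. by elim: a => // a IH; rewrite !mulrS -IH. Qed.

Lemma padic_abs_pi_le (e : rat) (u : padic_seq p_pr) : 0 <= e ->
  (exists N : nat, forall n, (N <= n)%N -> rat_padic_abs p (u n) <= e) ->
  abs (\pi_Qp u) <= e.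
Proof.
move=> e0 [N uN]; rewrite padic_abs_pi.
have [/padic_seq_abs0 -> //|/padic_seq_abs_const[_ [K uK]]] := boolP (u \in @padic_null p p_pr).
by rewrite -(uK _ (leq_maxr N K)) uN // leq_maxl.
Qed.

Lemma padic_abs_nat (a : nat) : abs a%:R = rat_padic_abs p a%:R.
Proof.
rewrite -[a%:R in LHS](rmorph_nat (\pi_Qp)) padic_abs_pi.
by apply: padic_seq_abs_eventually; exists 0%N => n _; rewrite padic_seq_nat.
Qed.

Lemma padic_abs_nat_le1 (a : nat) : abs a%:R <= 1.
Proof.
by rewrite padic_abs_nat; have := rat_padic_abs_int p_pr a 0; rewrite expr0 invr1 expn0 dvd1n pmulrn.
Qed.

Lemma padic_abs_natB (a b k : nat) :
  (abs (a%:R - b%:R) <= p%:R ^- k) = (a == b %[mod p ^ k])%N.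
Proof.
wlog ba : a b / (b <= a)%N.
  move=> W; have [/W//|/ltnW/W] := leqP b a.
  by rewrite eq_sym -padic_absN opprB.
rewrite -natrB // padic_abs_nat pmulrn rat_padic_abs_int // eqn_mod_dvd //.
Qed.

Lemma padic_nat_eq (a b k : nat) : (a < p ^ k)%N -> (b < p ^ k)%N ->
  (abs (a%:R - b%:R) <= p%:R ^- k) = (a == b).
Proof. by move=> ak bk; rewrite padic_abs_natB !modn_small. Qed.

Lemma padic_int_digit (x : Zp) k :
  exists a : 'I_(p ^ k)%N, abs (padic_int_val x - a%:R) <= p%:R ^- k.
Proof.
case: x => x x1 /=; move: x1; rewrite /in_mem /= /is_padic_int; elim/quotW: x => u.
rewrite padic_abs_pi => u1.
have [K uK] : exists K : nat, forall n, (K <= n)%N -> rat_padic_abs p (u n) <= 1.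
  have [/asboolP/(_ 1 ltr01)[K uK]|/padic_seq_abs_const[_ [K uK]]] :=
    boolP (u \in @padic_null p p_pr); exists K => n /uK; first exact: ltW.
  by move=> ->.
have /asboolP/(_ (p%:R ^- k) (prime_exp_gt0 k)) [N uN] := padic_seqP u.
(* A rational term of the sequence that is integral and already within [p ^- k] of the limit. Its
   denominator is prime to [p], so Bezout inverts the denominator modulo [p ^ k], and [b] below is
   the residue of [r]. *)
pose r := u (maxn N K); have r1 : rat_padic_abs p r <= 1 by rewrite uK // leq_maxr.
have pd : ~~ (p %| `|denq r|)%N.
  apply/negP => pd; have : rat_padic_abs p (numq r)%:~R <= p%:R ^- 1.
    rewrite -[(numq r)%:~R](divfK (x := (denq r)%:~R)) ?intr_eq0 ?denq_neq0 //.
    rewrite divq_num_den rat_padic_absM // -[leRHS]mul1r ler_pM ?rat_padic_abs_ge0 //.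
    by rewrite rat_padic_abs_int // expn1.
  rewrite rat_padic_abs_int // expn1 => pn.
  have : (p %| gcdn `|numq r| `|denq r|)%N by rewrite dvdn_gcd pn pd.
  by rewrite (eqP (coprime_num_den r)) dvdn1 => /eqP p1; move: (p_pr); rewrite p1.
pose q : int := (p ^ k)%N.
have q0 : q != 0 by rewrite eqz_nat -lt0n expn_gt0 prime_gt0.
have cop : coprimez q (denq r).
  by rewrite /coprimez /gcdz eqz_nat; apply: (coprimeXl k); rewrite prime_coprime.
have [[v w] /= vw] := coprimezP _ _ cop.
pose b : int := ((numq r * w) %% q)%Z.
have b0 : 0 <= b by apply: modz_ge0.
have bq : (`|b| < p ^ k)%N.
  by rewrite -ltz_nat gez0_abs // ltz_pmod // lt_def q0.
exists (Ordinal bq) => /=.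
rewrite -(rmorph_nat (\pi_Qp)) -(rmorphB (\pi_Qp)).
apply: padic_abs_pi_le; first exact: ltW.
exists (maxn N K) => n Nn.
rewrite -[padic_seq_val _ n]/(u n - (`|b|%N%:R : padic_seq p_pr) n) padic_seq_nat.
have -> : u n - `|b|%N%:R = (u n - r) + (r - b%:~R).
  by rewrite addrA subrK -{2}(gez0_abs b0) -pmulrn.
apply: le_trans (rat_padic_abs_ultra p_pr _ _) _; rewrite ge_max; apply/andP; split.
  by apply/ltW/uN; rewrite ?leq_maxl // (leq_trans _ Nn) // leq_maxl.
have dn : rat_padic_abs p (denq r)%:~R = 1.
  have := rat_padic_abs_frac p (denq_neq0 r) (oner_neq0 int); rewrite divr1 => ->.
  by rewrite logn1 lognE (negbTE pd) !andbF.
(* Multiplying by the denominator, of absolute value 1, turns the claim into a divisibility between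
   integers. *)
rewrite -[leLHS]mulr1 -[X in _ * X]dn -rat_padic_absM // mulrBl.
rewrite -{1}(divq_num_den r) divfK ?intr_eq0 ?denq_neq0 // -intrM -intrB rat_padic_abs_int //.
suff : (q %| numq r - b * denq r)%Z by [].
apply/dvdzP; exists (numq r * v + ((numq r * w) %/ q)%Z * denq r).
have -> : b = numq r * w - ((numq r * w) %/ q)%Z * q by rewrite {1}(divz_eq (numq r * w) q) addrC addKr.
move: vw; set d := denq r; set t := (_ %/ _)%Z => vw.
rewrite -[X in X - _]mulr1 -vw; ring.
Qed.

(** Not a single base-[p] digit but the whole residue modulo [p ^ k], that is, the first [k] digits
    together. *)
Definition digit k (x : Zp) : 'I_(p ^ k)%N := sval (cid (padic_int_digit x k)).

Lemma digit_near (x : Zp) k : abs (padic_int_val x - (digit k x : nat)%:R) <= p%:R ^- k.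
Proof. exact: svalP (cid (padic_int_digit x k)). Qed.

Lemma digit_uniq (x : Zp) k (a : 'I_(p ^ k)%N) :
  abs (padic_int_val x - (a : nat)%:R) <= p%:R ^- k -> digit k x = a.
Proof.
move=> xa; apply/val_inj/eqP; rewrite -(padic_nat_eq (ltn_ord _) (ltn_ord _)).
have -> : (digit k x : nat)%:R - (a : nat)%:R =
   (padic_int_val x - (a : nat)%:R) - (padic_int_val x - (digit k x : nat)%:R) by ring.
by apply: padic_absB_le => //; exact: digit_near.
Qed.

Lemma digit_eqP (x y : Zp) k :
  reflect (digit k x = digit k y) (abs (padic_int_val x - padic_int_val y) <= p%:R ^- k).
Proof.
apply: (iffP idP) => [xy|xy].
  apply: digit_uniq; rewrite -(subrK (padic_int_val y) (padic_int_val x)) -addrA.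
  by apply: padic_absD_le => //; exact: digit_near.
rewrite (_ : _ - _ = (padic_int_val x - (digit k x : nat)%:R)
  - (padic_int_val y - (digit k x : nat)%:R)); last by ring.
by apply: padic_absB_le; [exact: digit_near|rewrite xy; exact: digit_near].
Qed.

(** Replacing each [z k] by its residue [a k], which is within [p ^- k], gives a Cauchy sequence of
    rationals; its class is the limit. *)
Lemma padic_int_limit (z : nat -> Zp) :
  (forall k, abs (padic_int_val (z k.+1) - padic_int_val (z k)) <= p%:R ^- k) ->
  exists x : Zp, forall k, abs (padic_int_val x - padic_int_val (z k)) <= p%:R ^- k.
Proof.
move=> zk.
pose a k : nat := digit k (z k).
have za k := digit_near (z k) k : abs (padic_int_val (z k) - (a k)%:R) <= _.
pose u (n : nat) : rat := (a n)%:R.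
have za_le k n : (k <= n)%N -> abs (padic_int_val (z n) - padic_int_val (z k)) <= p%:R ^- k.
  move=> /subnK <-; elim: (n - k)%N => [|i IH]; first by rewrite add0n subrr padic_abs0.
  rewrite -(subrK (padic_int_val (z (i + k)%N)) (padic_int_val (z (i.+1 + k)%N))) -addrA.
  apply: padic_absD_le => //; apply: le_trans (zk _) _; apply: prime_exp_le; exact: leq_addl.
have ua k n : (k <= n)%N -> rat_padic_abs p (u n - u k) <= p%:R ^- k.
  move=> kn; rewrite /u !pmulrn -intrB rat_padic_abs_int //.
  have : abs ((a n)%:R - (a k)%:R) <= p%:R ^- k.
    rewrite (_ : _ - _ = (padic_int_val (z n) - padic_int_val (z k)) +
      ((padic_int_val (z k) - (a k)%:R) - (padic_int_val (z n) - (a n)%:R))); last by ring.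
    apply: padic_absD_le; first exact: za_le.
    apply: padic_absB_le; first exact: za.
    by apply: le_trans (za _) _; exact: prime_exp_le.
  rewrite padic_abs_natB // => E.
  suff : ((p ^ k)%N %| (a n)%:Z - (a k)%:Z)%Z by [].
  by rewrite -eqz_mod_dvd !modz_nat eqz_nat.
have uc : u \in padic_cauchy p_pr.
  apply/asboolP => e e0; have [k ke] := prime_exp_small e0; exists k => m n km kn.
  apply: le_lt_trans ke; rewrite (_ : _ - _ = (u m - u k) - (u n - u k)); last by ring.
  apply: le_trans (rat_padic_abs_ultra p_pr _ _) _.
  by rewrite rat_padic_absN ge_max !ua.
pose x : Qp := \pi_Qp (PadicSeq uc).
have xa k : abs (x - (a k)%:R) <= p%:R ^- k.
  rewrite -(rmorph_nat (\pi_Qp)) -(rmorphB (\pi_Qp)).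
  apply: padic_abs_pi_le; first exact: ltW.
  exists k => n kn.
  by rewrite -[padic_seq_val _ n]/(u n - ((a k)%:R : padic_seq p_pr) n) padic_seq_nat ua.
have x1 : x \in @is_padic_int p p_pr.
  rewrite /in_mem /= /is_padic_int -(subrK (a 0%N)%:R x); apply: padic_absD_le.
    by have := xa 0%N; rewrite expr0 invr1.
  exact: padic_abs_nat_le1.
exists (PadicInt x1) => k /=.
rewrite -(subrK (a k)%:R x) -addrA; apply: padic_absD_le => //.
by rewrite -padic_absN opprB.
Qed.

End PadicAbs.

(** * Congruences and uniform continuity *)

Section PadicVectors.
Variables (p : nat) (p_pr : prime p).
Local Notation Qp := (padic p_pr).
Local Notation Zp := (padic_int p_pr).
Local Notation abs := (@padic_abs p p_pr).

Lemma padic_norm_leP n (v : 'cV[Qp]_n) (e : rat) : 0 <= e ->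
  reflect (forall i, abs (v i 0) <= e) (padic_norm v <= e).
Proof.
move=> e0; apply: (iffP (bigmax_leP _ _ _ _)) => [[_ H] i|H]; first exact: H.
by split=> // i _; exact: H.
Qed.

Lemma padic_norm_ltP n (v : 'cV[Qp]_n) (e : rat) : 0 < e ->
  reflect (forall i, abs (v i 0) < e) (padic_norm v < e).
Proof.
move=> e0; apply: (iffP (bigmax_ltP _ _ _ _)) => [[_ H] i|H]; first exact: H.
by split=> // i _; exact: H.
Qed.

Lemma padic_abs_le_norm n (v : 'cV[Qp]_n) i : abs (v i 0) <= padic_norm v.
Proof. exact: (le_bigmax _ (fun j => abs (v j 0)) i). Qed.

Lemma padic_norm_ge0 n (v : 'cV[Qp]_n) : 0 <= padic_norm v.
Proof. exact: bigmax_ge_id. Qed.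

Lemma padic_normN n (v : 'cV[Qp]_n) : padic_norm (- v) = padic_norm v.
Proof. by apply: eq_bigr => i _; rewrite mxE padic_absN. Qed.

Lemma padic_normD_lt (e : rat) n (u v : 'cV[Qp]_n) :
  padic_norm u < e -> padic_norm v < e -> padic_norm (u + v) < e.
Proof.
move=> ue ve; have e0 := le_lt_trans (padic_norm_ge0 u) ue.
apply/padic_norm_ltP => // i; rewrite mxE; apply: padic_absD_lt.
  by move/padic_norm_ltP : ue; apply.
by move/padic_norm_ltP : ve; apply.
Qed.

Definition congruent n k (x y : 'cV[Zp]_n) :=
  forall i, digit k (x i 0) = digit k (y i 0).

Lemma congruentP n k (x y : 'cV[Zp]_n) : congruent k x y <->
  forall i, abs (padic_int_val (x i 0) - padic_int_val (y i 0)) <= p%:R ^- k.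
Proof. by split=> xy i; apply/digit_eqP; exact: xy. Qed.

Lemma congruentW n j k (x y : 'cV[Zp]_n) : (j <= k)%N ->
  congruent k x y -> congruent j x y.
Proof.
move=> jk /congruentP xy; apply/congruentP => i.
by apply: le_trans (xy i) _; exact: prime_exp_le.
Qed.

Lemma nbhs_congruent n (x : 'cV[Zp]_n) k : nbhs x (congruent k x).
Proof.
rewrite -nbhs_ballE; exists (p%:R ^- k); first exact: prime_exp_gt0.
move=> y [_ xy]; apply/congruentP => i; exact: ltW (xy i 0).
Qed.

Lemma locally_constant_continuous n m k (f : 'cV[Zp]_n -> 'cV[Qp]_m) :
  (forall x y, congruent k x y -> f x = f y) -> continuous f.
Proof.
move=> fk x A /= fxA; apply: filterS (nbhs_congruent x k) => y /fk xy.
rewrite /preimage /= -xy; exact: nbhs_singleton.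
Qed.

Lemma open_congruent n (A : set 'cV[Zp]_n) :
  (forall x, A x -> exists k, forall y, congruent k x y -> A y) -> open A.
Proof.
move=> Ak; rewrite openE => x /Ak [k xk].
by apply: filterS (nbhs_congruent x k) => y; exact: xk.
Qed.

Lemma continuous_congruent n m (f : 'cV[Zp]_n -> 'cV[Qp]_m) : continuous f ->
  forall x (e : rat), 0 < e ->
  exists k, forall y, congruent k x y -> padic_norm (f x - f y) < e.
Proof.
move=> fc x e e0.
have /nbhs_ballP[d d0 xd] : nbhs x (f @^-1` ball (f x) e).
  by apply: fc; exact: nbhsx_ballx.
have [k kd] := prime_exp_small p_pr d0; exists k => y /congruentP xy.
apply/padic_norm_ltP => // i; rewrite !mxE.
have [_ ] : ball (f x) e (f y); last by apply.
apply: xd; split=> // a b; rewrite (ord1 b).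
by apply: le_lt_trans kd; exact: xy.
Qed.

(* Compactness of [Z_p^n]: if the conclusion failed, it would fail on nested
   residue classes modulo [p ^ k], and then near their common point. *)
Lemma uniform_congruent n m (f : 'cV[Zp]_n -> 'cV[Qp]_m) (e : rat) :
  continuous f -> 0 < e ->
  exists k, forall x y, congruent k x y -> padic_norm (f x - f y) < e.
Proof.
move=> fc e0.
(* Uniformity of [f], for this [e], on the class of [z] modulo [p ^ k]. *)
pose good k z := exists K, forall x y, congruent k z x -> congruent k z y ->
  congruent K x y -> padic_norm (f x - f y) < e.
have triv (x y : 'cV[Zp]_n) : congruent 0 x y.
  apply/congruentP => i; rewrite expr0 invr1.
  by apply: padic_absB_le; exact: padic_intP.
suff [K HK] : good 0%N 0 by exists K => x y; exact: HK.
apply: contrapT => bad0.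
have step k z : ~ good k z -> exists z', congruent k z z' /\ ~ good k.+1 z'.
  move=> badz; apply: contrapT => /forallNP all_good; apply: badz.
  (* [dv] labels the finitely many classes modulo [p ^ k.+1]. If those inside the class of [z] were
     all good, the maximum of their moduli [K t] would serve for [z]. *)
  pose dv (x : 'cV[Zp]_n) : {ffun 'I_n -> 'I_(p ^ k.+1)%N} := [ffun i => digit k.+1 (x i 0)].
  have dvP (x y : 'cV[Zp]_n) : dv x = dv y -> congruent k.+1 x y.
    by move=> E i; have := congr1 (fun h : {ffun _} => h i) E; rewrite !ffunE.
  have K_ex (t : {ffun 'I_n -> 'I_(p ^ k.+1)%N}) : exists K, forall x y,
      congruent k z x -> dv x = t -> dv y = t -> congruent K x y ->
      padic_norm (f x - f y) < e.
    have [[x [zx xt]]|none] := pselect (exists x, congruent k z x /\ dv x = t); last first.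
      by exists 0%N => x y zx xt; case: none; exists x.
    have /not_andP[//|/contrapT[K HK]] := all_good x.
    by exists K => a b _ dva dvb; apply: HK; apply: dvP; rewrite xt ?dva ?dvb.
  have [K HK] := choice K_ex.
  exists (maxn k.+1 (\max_t K t)) => x y zx zy xy.
  apply: (HK (dv x)) => //.
    by apply/ffunP => i; rewrite !ffunE; apply/esym; apply: congruentW xy i; exact: leq_maxl.
  apply: congruentW xy; rewrite leq_max; apply/orP; right.
  exact: (leq_bigmax (dv x)).
pose next k z := xget z [set z' | congruent k z z' /\ ~ good k.+1 z'].
pose zs := fix zs k := if k is j.+1 then next j (zs j) else 0 : 'cV[Zp]_n.
have zsP k : ~ good k (zs k).
  elim: k => [|k IH] //=; rewrite /next; case: xgetP => [z' _ []//|none].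
  by have [z' z'P] := step _ _ IH; case: (none z').
have zs_next k : congruent k (zs k) (zs k.+1).
  rewrite /= /next; case: xgetP => [z' _ []//|none].
  by have [z' z'P] := step _ _ (zsP k); case: (none z').
have lim i : exists x : Zp, forall k,
    abs (padic_int_val x - padic_int_val (zs k i 0)) <= p%:R ^- k.
  apply: padic_int_limit => k; rewrite -padic_absN opprB.
  by move/congruentP : (zs_next k); apply.
have [x xP] := choice lim.
have xz k : congruent k (\col_i x i) (zs k).
  by apply/congruentP => i; rewrite mxE.
have [k kP] := continuous_congruent fc (\col_i x i) e0.
(* On the class of [zs k] all values of [f] are within [e] of the value at the limit, so any modulus
   makes this class good. *)
apply: (zsP k); exists 0%N => a b za zb _.
have H y : congruent k (zs k) y -> padic_norm (f (\col_i x i) - f y) < e.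
  by move=> zy; apply: kP => i; rewrite xz zy.
rewrite -(subrK (f (\col_i x i)) (f a)) -addrA; apply: padic_normD_lt; last exact: H.
by rewrite -padic_normN opprB; exact: H.
Qed.

End PadicVectors.

(** * Realizable functions *)

Section Realizable.
Variables (p : nat) (p_pr : prime p) (w n : nat).
Local Notation Qp := (padic p_pr).
Local Notation Zp := (padic_int p_pr).
Local Notation abs := (@padic_abs p p_pr).
Local Notation embed x := (map_mx (@padic_int_val p p_pr) x).
Local Notation X := 'cV[Zp]_n.

Lemma pReLU_int (x : Qp) : abs x <= 1 -> pReLU x = x.
Proof. by move=> x1; rewrite /pReLU /in_mem /= /is_padic_int x1. Qed.

Lemma pReLU_nint (x : Qp) : 1 < abs x -> pReLU x = 0.
Proof. by move=> x1; rewrite /pReLU /in_mem /= /is_padic_int leNgt x1. Qed.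

(* [F] is the state of some hidden layer of dimension [w], as a function of the
   input, in a network all of whose previous hidden layers have dimension at
   most [w]: every network of width at most [w] can be appended to it. *)
Definition hidden_state (F : X -> 'cV[Qp]_w) : Prop :=
  forall dy (N : network p_pr dy w), (network_width N <= w)%N ->
  exists2 N0 : network p_pr dy n, network_width N0 = w &
    forall x, network_eval N0 (embed x) = network_eval N (F x).

(** An affine readout of a hidden state. No activation follows the readout, so affine maps can be
    applied freely, and [m] may differ from [w]. *)
Definition realizable m (G : X -> 'cV[Qp]_m) : Prop :=
  exists F : X -> 'cV[Qp]_w, hidden_state F /\
  exists (C : 'M[Qp]_(m, w)) c, forall x, G x = C *m F x + c.

Lemma network_width_hidden dy m d (A : 'M[Qp]_(d, m)) b (N : network p_pr dy d) :
  network_width (Hidden A b N) = maxn d (network_width N).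
Proof. by rewrite /network_width /= big_cons. Qed.

Lemma hidden_state_embed (A : 'M[Qp]_(w, n)) b :
  hidden_state (fun x => map_mx (@pReLU p p_pr) (A *m embed x + b)).
Proof.
move=> dy N Nw; exists (Hidden A b N) => //.
by rewrite network_width_hidden; apply/maxn_idPl.
Qed.

Lemma hidden_state_next F (A : 'M[Qp]_w) b : hidden_state F ->
  hidden_state (fun x => map_mx (@pReLU p p_pr) (A *m F x + b)).
Proof.
move=> HF dy N Nw; have [|N0 N0w N0E] := HF dy (Hidden A b N).
  by rewrite network_width_hidden geq_max leqnn.
by exists N0 => // x; rewrite N0E.
Qed.

Lemma realizable_ext m (G H : X -> 'cV[Qp]_m) : G =1 H -> realizable G -> realizable H.
Proof.
move=> GH [F [HF [C [c E]]]]; exists F; split=> //.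
by exists C, c => x; rewrite -GH.
Qed.

Lemma realizable_affine m m' (G : X -> 'cV[Qp]_m) (A : 'M[Qp]_(m', m)) b :
  realizable G -> realizable (fun x => A *m G x + b).
Proof.
move=> [F [HF [C [c E]]]]; exists F; split=> //.
by exists (A *m C), (A *m c + b) => x; rewrite E mulmxDr mulmxA addrA.
Qed.

Lemma realizable_scale m (G : X -> 'cV[Qp]_m) (a : Qp) b :
  realizable G -> realizable (fun x => a *: G x + b).
Proof.
move=> /(realizable_affine (a *: 1%:M) b); apply: realizable_ext => x.
by rewrite -scalemxAl mul1mx.
Qed.

Lemma map_pReLU_pad m r (v : 'cV[Qp]_m) (z : 'cV[Qp]_r) :
  row_mx 1%:M 0 *m map_mx (@pReLU p p_pr) (col_mx v z) = map_mx (@pReLU p p_pr) v.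
Proof. by rewrite map_col_mx mul_row_col mul1mx mul0mx addr0. Qed.

Lemma realizable_pReLU m (G : X -> 'cV[Qp]_m) : (m <= w)%N ->
  realizable G -> realizable (fun x => map_mx (@pReLU p p_pr) (G x)).
Proof.
move=> mw; have [r wE] : exists r, w = (m + r)%N by exists (w - m)%N; rewrite subnKC.
move=> [F [HF [C [c E]]]].
(* [P] places the [m] values in the first neurons and fills the others with zeros; [Q] reads them
   back. *)
pose P : 'M[Qp]_(w, m) := castmx (esym wE, erefl) (col_mx 1%:M 0).
pose Q : 'M[Qp]_(m, w) := castmx (erefl, esym wE) (row_mx 1%:M 0).
have QP (v : 'cV[Qp]_m) : Q *m map_mx (@pReLU p p_pr) (P *m v) = map_mx (@pReLU p p_pr) v.
  rewrite /Q /P; case: w / (esym wE) => /=; rewrite !castmx_id.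
  by rewrite mul_col_mx mul1mx map_pReLU_pad.
exists (fun x => map_mx (@pReLU p p_pr) ((P *m C) *m F x + P *m c)); split.
  exact: hidden_state_next.
by exists Q, 0 => x; rewrite addr0 -mulmxA -mulmxDr -E QP.
Qed.

Lemma embed_int (x : X) i : abs (embed x i 0) <= 1.
Proof. by rewrite mxE; exact: padic_intP. Qed.

Lemma realizable_embed : (n <= w)%N -> realizable (fun x => embed x).
Proof.
move=> mw; have [r wE] : exists r, w = (n + r)%N by exists (w - n)%N; rewrite subnKC.
pose P : 'M[Qp]_(w, n) := castmx (esym wE, erefl) (col_mx 1%:M 0).
pose Q : 'M[Qp]_(n, w) := castmx (erefl, esym wE) (row_mx 1%:M 0).
have QP (v : 'cV[Qp]_n) : Q *m map_mx (@pReLU p p_pr) (P *m v) = map_mx (@pReLU p p_pr) v.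
  rewrite /Q /P; case: w / (esym wE) => /=; rewrite !castmx_id.
  by rewrite mul_col_mx mul1mx map_pReLU_pad.
exists (fun x => map_mx (@pReLU p p_pr) (P *m embed x + 0)); split.
  exact: hidden_state_embed.
exists Q, 0 => x; rewrite !addr0 QP; apply/matrixP => i j; rewrite (ord1 j) [RHS]mxE.
by rewrite pReLU_int ?embed_int // mxE.
Qed.

(** Scaled by [p ^ k], the bounded state [G] is integral, passes through [pReLU] unchanged and is
    scaled back afterwards. The one spare neuron computes the added term. *)
Lemma realizable_bump m (G : X -> 'cV[Qp]_m) (l : 'rV[Qp]_m) (b : 'cV[Qp]_1)
    (v : 'cV[Qp]_m) (k : nat) :
  (m < w)%N -> (forall x i, abs (G x i 0) <= p%:R ^+ k) -> realizable G ->
  realizable (fun x => G x + pReLU ((l *m G x + b) 0 0) *: v).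
Proof.
move=> mw Gk HG; pose c : Qp := p%:R ^+ k.
have H1 : realizable (fun x => col_mx (c *: 1%:M) l *m G x + col_mx 0 b) by exact: realizable_affine.
have H2 : realizable (fun x => map_mx (@pReLU p p_pr) (col_mx (c *: G x) (l *m G x + b))).
  apply: realizable_pReLU; first by rewrite addn1.
  apply: realizable_ext H1 => x.
  by rewrite mul_col_mx add_col_mx addr0 -scalemxAl mul1mx.
apply: realizable_ext (realizable_affine (row_mx (c^-1 *: 1%:M) v) 0 H2) => x.
rewrite addr0 map_col_mx mul_row_col -scalemxAl mul1mx; congr (_ + _).
  apply/matrixP => i j; rewrite (ord1 j) !mxE pReLU_int.
    by rewrite mulrA mulVf ?mul1r // padic_primeX_neq0.
  by rewrite padic_absM padic_abs_primeX ler_pdivrMl ?mulr1 ?exprn_gt0 ?prime_gt0_rat.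
by apply/matrixP => i j; rewrite (ord1 j) !mxE big_ord1 !mxE mulrC.
Qed.

Lemma realizable_network dy (G : X -> 'cV[Qp]_dy) : realizable G ->
  exists2 N : network p_pr dy n, network_width N = w & forall x, network_eval N (embed x) = G x.
Proof.
move=> [F [HF [C [c E]]]]; have [|N Nw NE] := HF _ (Output C c).
  by rewrite /network_width big_nil.
by exists N => // x; rewrite NE E.
Qed.

End Realizable.

(** * Uniqueness of base expansions *)

Lemma base_expansion_lt b n (a : 'I_n -> nat) : (forall i, (a i < b)%N) ->
  (\sum_(i < n) a i * b ^ i < b ^ n)%N.
Proof.
elim: n a => [|n IH] a ab; first by rewrite big_ord0.
rewrite big_ord_recr /= expnS.
apply: (@leq_trans ((a ord_max).+1 * b ^ n)); last by rewrite leq_mul2r ab orbT.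
by rewrite mulSn ltn_add2r; apply: (IH (fun i => a (widen_ord (leqnSn n) i))).
Qed.

(** The lower part is less than [b ^ n], so division by [b ^ n] recovers the leading digit. *)
Lemma base_expansion_inj b n (a a' : 'I_n -> nat) :
  (forall i, (a i < b)%N) -> (forall i, (a' i < b)%N) ->
  (\sum_(i < n) a i * b ^ i = \sum_(i < n) a' i * b ^ i)%N -> a =1 a'.
Proof.
elim: n a a' => [|n IH] a a' ab a'b; first by move=> _ [].
have lt := base_expansion_lt (fun i => ab (widen_ord (leqnSn n) i)).
have lt' := base_expansion_lt (fun i => a'b (widen_ord (leqnSn n) i)).
rewrite !big_ord_recr /= => E.
have b0 : (0 < b ^ n)%N by apply: leq_ltn_trans lt.
have Emax : a ord_max = a' ord_max.
  have := congr1 (fun m => m %/ b ^ n)%N E.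
  by rewrite /= !divnDr ?dvdn_mull // !mulnK // (divn_small lt) (divn_small lt').
move: E; rewrite Emax => /addIn /(IH _ _ (fun i => ab _) (fun i => a'b _)) E i.
case: (unliftP ord_max i) => [j ->|-> //].
have -> : lift ord_max j = widen_ord (leqnSn n) j by apply: val_inj; rewrite /= /bump leqNgt ltn_ord.
exact: E.
Qed.

(** * Rounding, encoding and approximation by wide networks *)

Section Sufficiency.
Variables (p : nat) (p_pr : prime p) (w n : nat).
Local Notation Qp := (padic p_pr).
Local Notation Zp := (padic_int p_pr).
Local Notation abs := (@padic_abs p p_pr).
Local Notation embed x := (map_mx (@padic_int_val p p_pr) x).
Local Notation X := 'cV[Zp]_n.

Definition code k (x : X) : nat := (\sum_(i < n) digit k (x i 0%R) * (p ^ k) ^ i)%N.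

Lemma code_lt k (x : X) : (code k x < p ^ (k * n))%N.
Proof. by rewrite expnM; apply: base_expansion_lt => i; exact: ltn_ord. Qed.

Lemma codeP k (x y : X) : code k x = code k y <-> congruent k x y.
Proof.
split=> [E i|E]; last by apply: eq_bigr => i _; rewrite E.
by apply/val_inj; apply: base_expansion_inj E i => i; exact: ltn_ord.
Qed.

(** [S] lists the pairs of a coordinate and a residue class that have already been collapsed, one
    hidden layer being spent on each. *)
Definition rounded k (S : seq ('I_n * 'I_(p ^ k)%N)) (x : X) : 'cV[Qp]_n :=
  \col_i (if (i, digit k (x i 0)) \in S then (digit k (x i 0) : nat)%:R
          else padic_int_val (x i 0)).

Lemma abs_primeXV_mul (k : nat) (z : Qp) : (abs (p%:R ^- k * z) <= 1) = (abs z <= p%:R ^- k).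
Proof.
by rewrite padic_absM padic_abs_primeXV mulrC -ler_pdivlMr ?mul1r ?exprn_gt0 ?prime_gt0_rat.
Qed.

(* Adding [- p ^ k * pReLU (p ^- k * (x_i - a))] moves the ball of radius
   [p ^- k] around [a] to its centre and fixes the other integral points. *)
Lemma realizable_rounded k S : (n < w)%N -> realizable w (@rounded k S).
Proof.
move=> nw; elim: S => [|[i0 a] S IH].
  apply: realizable_ext (realizable_embed p_pr (ltnW nw)) => x.
  by apply/matrixP => i j; rewrite (ord1 j) !mxE.
have bnd x i : abs (rounded S x i 0) <= p%:R ^+ 0.
  rewrite mxE expr0; case: ifP => _; [exact: padic_abs_nat_le1|exact: padic_intP].
apply: realizable_ext (realizable_bump (p%:R ^- k *: delta_mx 0 i0)
  (const_mx (- (p%:R ^- k * (a : nat)%:R))) (- p%:R ^+ k *: delta_mx i0 0) nw bnd IH) => x.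
apply/matrixP => i j; rewrite (ord1 j) -scalemxAl -rowE !mxE -mulrN -mulrDr.
rewrite eqxx andbT in_cons xpair_eqE; set d := digit k (x i0 0).
set r := if (i0, d) \in S then _ else _.
have rd : abs (r - (d : nat)%:R) <= p%:R ^- k.
  rewrite /r; case: ifP => _; last exact: digit_near.
  by rewrite subrr padic_abs0 ltW // prime_exp_gt0.
have [->|ii0] /= := eqVneq i i0; last by rewrite mulr0 mulr0 addr0.
rewrite -/d -/r mulr1; have [da|da] /= := eqVneq d a.
  rewrite pReLU_int; last by rewrite abs_primeXV_mul -da.
  by rewrite mulrN mulrC mulrA mulfV ?padic_primeX_neq0 // mul1r opprB addrC subrK da.
rewrite pReLU_nint ?mul0r ?addr0 // ltNge abs_primeXV_mul; apply: contra da => ra.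
apply/eqP/val_inj/eqP; rewrite -(padic_nat_eq p_pr (ltn_ord d) (ltn_ord a)).
rewrite (_ : _ - _ = (r - (a : nat)%:R) - (r - (d : nat)%:R)); last by ring.
exact: padic_absB_le.
Qed.

(** Once every coordinate is rounded in every class, the code is a linear form in the state, with
    weights [(p ^ k) ^ i]. *)
Lemma realizable_code k : (n < w)%N ->
  realizable w (fun x : X => const_mx (code k x)%:R : 'cV[Qp]_1).
Proof.
move=> nw; have := realizable_affine (\row_i ((p ^ k) ^ i)%:R) 0
   (realizable_rounded (index_enum ('I_n * 'I_(p ^ k)%N)%type) nw).
apply: realizable_ext => x; apply/matrixP => i j; rewrite addr0 !mxE.
by rewrite natr_sum; apply: eq_bigr => l _; rewrite !mxE mem_index_enum natrM mulrC.
Qed.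

(* Points of distinct absolute values can be moved one by one, the largest first,
   by a single neuron per coordinate. *)
Definition target B j : Qp := p%:R ^- (B + j.+1).

Lemma abs_target B j : abs (target B j) = p%:R ^+ (B + j.+1).
Proof. exact: padic_abs_primeXV. Qed.

(** The codes are moved in decreasing order, the codes at least [p ^ K - j] being done after [j]
    steps. One neuron carries the state and a second one detects the code to be moved. *)
Lemma realizable_spread k B : (n < w)%N -> (1 < w)%N ->
  realizable w (fun x : X => const_mx (target B (code k x)) : 'cV[Qp]_1).
Proof.
move=> nw w1; set K := (k * n)%N.
suff H j : (j <= p ^ K)%N -> realizable w (fun x : X =>
    const_mx (if (p ^ K - j <= code k x)%N then target B (code k x) else (code k x)%:R) : 'cV[Qp]_1).
  by apply: realizable_ext (H _ (leqnn _)) => x; rewrite subnn leq0n.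
elim: j => [_|j IH jK].
  apply: realizable_ext (realizable_code k nw) => x.
  by rewrite subn0 leqNgt code_lt.
set i := (p ^ K - j.+1)%N; have Ei : (p ^ K - j = i.+1)%N by rewrite /i; lia.
have iK : (i < p ^ K)%N by rewrite /i; lia.
move: IH; rewrite Ei => /(_ (ltnW jK)) IH.
have bnd x (l : 'I_1) : abs ((const_mx (if (i < code k x)%N then target B (code k x)
     else (code k x)%:R) : 'cV[Qp]_1) l 0) <= p%:R ^+ (B + p ^ K).
  rewrite mxE; case: ifP => _; last first.
    by apply: le_trans (padic_abs_nat_le1 _ _) _; rewrite exprn_ege1 // ltW // prime_gt1_rat.
  by rewrite abs_target ler_eXn2l ?prime_gt1_rat // leq_add2l code_lt.
(* The spare neuron computes [pReLU (p ^- K * (u - i) + 1)]. It is 1 at [u = i], thanks to the shift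
   by 1. Other codes below [p ^ K] and the targets already reached are farther than [p ^- K] from
   [i], so they give a non-integral argument and the value 0. *)
apply: realizable_ext (realizable_bump (p%:R ^- K)%:M
  (const_mx (1 - p%:R ^- K * i%:R)) (const_mx (target B i - i%:R)) w1 bnd IH) => x.
apply/matrixP => a b; rewrite mul_scalar_mx !mxE; set u := if _ then _ else _.
rewrite addrCA -mulrBr.
have [ci|ci|ci] := ltngtP (code k x) i.
- rewrite {1}/u ltnNge (ltnW ci) /= pReLU_nint ?mul0r ?addr0 //; last first.
    rewrite ltNge; apply/negP => /(padic_absB_le)/(_ (_ : abs 1 <= 1)).
    rewrite padic_abs1 lexx => /(_ isT); rewrite addrAC subrr add0r abs_primeXV_mul.
    by rewrite /u ltnNge (ltnW ci) /= padic_nat_eq ?code_lt // ltn_eqF.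
- rewrite {1}/u ci pReLU_nint ?mul0r ?addr0 //.
  have t1 : 1 < abs (target B (code k x)) by rewrite abs_target exprn_egt1 ?prime_gt1_rat // addnS.
  have : abs (u - i%:R) = abs (target B (code k x)).
    rewrite /u ci padic_abs_dominant // padic_absN.
    exact: le_lt_trans (padic_abs_nat_le1 _ _) t1.
  move=> E; rewrite ltNge; apply/negP => /(padic_absB_le)/(_ (_ : abs 1 <= 1)).
  rewrite padic_abs1 lexx => /(_ isT); rewrite addrAC subrr add0r abs_primeXV_mul E.
  by rewrite leNgt (le_lt_trans _ t1) // prime_exp_le1.
- rewrite /u ci ltnn subrr mulr0 addr0 pReLU_int ?padic_abs1 // mul1r addrC subrK //.
Qed.

(** The waiting points lie on the diagonal, beyond all values [c j], with absolute values increasing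
    with the code. Shifting by [c i] and scaling makes exactly the outermost waiting point
    non-integral: [pReLU] sends it to 0, and undoing the affine map puts it at [c i]. *)
Lemma realizable_code_function dy k (c : nat -> 'cV[Qp]_dy) :
  (n < w)%N -> (1 < w)%N -> (dy <= w)%N -> realizable w (fun x : X => c (code k x)).
Proof.
move=> nw w1 dyw; set K := (k * n)%N.
have [B cB] : exists B, forall j : 'I_(p ^ K)%N, padic_norm (c j) <= p%:R ^+ B.
  have [B HB] := prime_exp_bound p_pr (\big[Num.max/0]_(j < p ^ K) padic_norm (c j)).
  exists B => j; apply: le_trans HB.
  exact: (le_bigmax _ (fun j : 'I_(p ^ K)%N => padic_norm (c j)) j).
suff H j : (j <= p ^ K)%N -> realizable w (fun x : X =>
    if (p ^ K - j <= code k x)%N then c (code k x) else const_mx (target B (code k x))).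
  by apply: realizable_ext (H _ (leqnn _)) => x; rewrite subnn leq0n.
elim: j => [_|j IH jK].
  apply: realizable_ext (realizable_affine (const_mx 1) 0 (realizable_spread k B nw w1)) => x.
  rewrite subn0 leqNgt code_lt addr0; apply/matrixP => a b.
  by rewrite !mxE big_ord1 !mxE mul1r.
set i := (p ^ K - j.+1)%N; have Ei : (p ^ K - j = i.+1)%N by rewrite /i; lia.
have iK : (i < p ^ K)%N by rewrite /i; lia.
move: IH; rewrite Ei => /(_ (ltnW jK)) IH.
(* With this factor the waiting point of code [i] gets absolute value [p] in each coordinate, while
   smaller waiting points and all the values [c m] become integral. *)
pose l : Qp := p%:R ^+ (B + i); have l0 : l != 0 by exact: padic_primeX_neq0.
apply: realizable_ext (realizable_scale l^-1 (c i) (realizable_pReLU dyw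
   (realizable_scale l (- (l *: c i)) IH))) => x.
have small m a : (m < p ^ K)%N -> abs (l * c m a 0) <= 1.
  move=> mK; rewrite padic_absM padic_abs_primeX ler_pdivrMl ?exprn_gt0 ?prime_gt0_rat // mulr1.
  apply: le_trans (padic_abs_le_norm _ _) (le_trans (cB (Ordinal mK)) _).
  by rewrite ler_eXn2l ?prime_gt1_rat // leq_addr.
have absl m : abs (l * target B m) = p%:R ^+ (B + m.+1) / p%:R ^+ (B + i).
  by rewrite padic_absM padic_abs_primeX abs_target mulrC.
apply/matrixP => a b; rewrite (ord1 b) !mxE.
have [ci|ci|ci] := ltngtP (code k x) i.
- rewrite !mxE pReLU_int; first by rewrite mulrDr mulrN !mulrA mulVf // !mul1r subrK.
  apply: padic_absB_le; last exact: small.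
  rewrite absl ler_pdivrMr ?exprn_gt0 ?prime_gt0_rat // mul1r ler_eXn2l ?prime_gt1_rat //.
  by rewrite leq_add2l.
- rewrite pReLU_int; first by rewrite mulrDr mulrN !mulrA mulVf // !mul1r subrK.
  by apply: padic_absB_le; apply: small; rewrite ?code_lt.
- rewrite ci mxE pReLU_nint ?mulr0 ?add0r //.
  rewrite padic_abs_dominant ?padic_absN absl addnS exprS mulfK ?gt_eqF ?exprn_gt0
    ?prime_gt0_rat //; first exact: prime_gt1_rat.
  exact: le_lt_trans (small _ _ iK) (prime_gt1_rat p_pr).
Qed.

Lemma uniform_approximation dy (f : X -> 'cV[Qp]_dy) (e : rat) :
  (n < w)%N -> (1 < w)%N -> (dy <= w)%N -> continuous f -> 0 < e ->
  exists2 N : network p_pr dy n, network_width N = w &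
    forall x, padic_norm (f x - network_eval N (embed x)) < e.
Proof.
move=> nw w1 dyw fc e0; have [k fk] := uniform_congruent fc e0.
(* The value of [f] at a chosen point of the class of code [j]; the default 0 is taken only for
   codes that do not occur. *)
pose c j := f (xget 0 [set x | code k x = j]).
have [N Nw NE] := realizable_network (realizable_code_function k c nw w1 dyw).
exists N => // x; rewrite NE; apply: fk; apply/codeP.
by rewrite (@xgetPex _ 0 [set y | code k y = code k x]) //; exists x.
Qed.

End Sufficiency.

(** * Obstructions *)

Lemma padic_int_valD p (p_pr : prime p) (x y : padic_int p_pr) :
  padic_int_val (x + y) = padic_int_val x + padic_int_val y.
Proof. by []. Qed.

Lemma padic_int_val1 p (p_pr : prime p) : padic_int_val (1 : padic_int p_pr) = 1.
Proof. by []. Qed.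

Lemma padic_int_valN p (p_pr : prime p) (x : padic_int p_pr) :
  padic_int_val (- x) = - padic_int_val x.
Proof. by []. Qed.

Lemma padic_int_val_nat p (p_pr : prime p) (a : nat) :
  padic_int_val (a%:R : padic_int p_pr) = a%:R.
Proof. by elim: a => // a IH; rewrite !mulrS padic_int_valD IH. Qed.

#[local] Opaque padic_abs padic_int_val.

Section Necessity.
Variables (p : nat) (p_pr : prime p).
Local Notation Qp := (padic p_pr).
Local Notation Zp := (padic_int p_pr).
Local Notation abs := (@padic_abs p p_pr).
Local Notation embed x := (map_mx (@padic_int_val p p_pr) x).

Lemma prime_exp_neq0 k : p%:R ^+ k != 0 :> rat.
Proof. by rewrite expf_neq0 // gt_eqF // prime_gt0_rat. Qed.

Lemma embedD n (x y : 'cV[Zp]_n) : embed (x + y) = embed x + embed y.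
Proof. by apply/matrixP => i j; rewrite !mxE. Qed.

Lemma integral_lift n (v : 'cV[Qp]_n) : (forall i, abs (v i 0) <= 1) ->
  exists z : 'cV[Zp]_n, embed z = v.
Proof.
move=> v1; exists (\col_i PadicInt (v1 i)).
by apply/matrixP => i j; rewrite (ord1 j) !mxE.
Qed.

(** Dividing a nonzero vector by such an entry yields an integral vector with an entry equal to
    1. *)
Lemma padic_abs_argmax n (v : 'I_n -> Qp) i0 : v i0 != 0 ->
  exists2 i, v i != 0 & forall j, abs (v j) <= abs (v i).
Proof.
move=> v0; have [i _ iP] := @Order.TotalTheory.arg_maxP _ _ _ i0 xpredT (fun i => abs (v i)) isT.
exists i => [|j]; last exact: iP.
rewrite -padic_abs_eq0 gt_eqF // (lt_le_trans _ (iP i0 isT)) //.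
by rewrite lt_def padic_abs_eq0 v0 padic_abs_ge0.
Qed.

Lemma padic_abs_mulmx_le m n (A : 'M[Qp]_(m, n)) L (v : 'cV[Qp]_n) (e : rat) :
  (forall i j, abs (A i j) <= p%:R ^+ L) -> padic_norm v <= e ->
  padic_norm (A *m v) <= p%:R ^+ L * e.
Proof.
move=> AL ve; have e0 := le_trans (padic_norm_ge0 v) ve.
have p0 : 0 <= p%:R ^+ L :> rat by rewrite exprn_ge0 // ltW // prime_gt0_rat.
apply/padic_norm_leP => [|i]; first exact: mulr_ge0.
rewrite mxE; apply: padic_abs_sum_le => [|j _]; first exact: mulr_ge0.
rewrite padic_absM ler_pM ?padic_abs_ge0 //.
by apply: le_trans (padic_abs_le_norm v j) ve.
Qed.

Lemma map_pReLUE n (v : 'cV[Qp]_n) i :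
  map_mx (@pReLU p p_pr) v i 0 = pReLU (v i 0).
Proof. by rewrite mxE. Qed.

(** Two points at distance at most 1 are either both integral or both non-integral. *)
Lemma pReLU_nonexpansive (x y : Qp) j :
  abs (x - y) <= p%:R ^- j -> abs (pReLU x - pReLU y) <= p%:R ^- j.
Proof.
move=> xy; have xy1 : abs (x - y) <= 1 := le_trans xy (prime_exp_le1 p_pr j).
have [x1|x1] := leP (abs x) 1.
  rewrite !pReLU_int // -[y](subKr x).
  exact: padic_absB_le.
rewrite !pReLU_nint ?subrr ?padic_abs0 ?ltW ?prime_exp_gt0 //.
rewrite ltNge; apply: contraL x1 => y1; rewrite -leNgt -(subrK y x).
exact: padic_absD_le.
Qed.

Lemma map_pReLU_nonexpansive n (u v : 'cV[Qp]_n) j : padic_norm (u - v) <= p%:R ^- j ->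
  padic_norm (map_mx (@pReLU p p_pr) u - map_mx (@pReLU p p_pr) v) <= p%:R ^- j.
Proof.
have pj : 0 <= p%:R ^- j :> rat by rewrite ltW // prime_exp_gt0.
move=> /(padic_norm_leP _ pj) uv; apply/(padic_norm_leP _ pj) => i; rewrite !mxE.
by apply: pReLU_nonexpansive; have := uv i; rewrite !mxE.
Qed.

Lemma affine_uniform m n (A : 'M[Qp]_(m, n)) b j : exists k, forall x y : 'cV[Qp]_n,
  padic_norm (x - y) <= p%:R ^- k ->
  padic_norm ((A *m x + b) - (A *m y + b)) <= p%:R ^- j.
Proof.
have [L HL] := prime_exp_bound p_pr (\big[Num.max/0]_i \big[Num.max/0]_l abs (A i l)).
exists (L + j)%N => x y xy.
rewrite opprD addrACA subrr addr0 -mulmxBr.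
apply: le_trans (padic_abs_mulmx_le _ xy) _.
  move=> i l; apply: le_trans HL.
  apply: le_trans (le_bigmax _ (fun i => \big[Num.max/0]_l abs (A i l)) i).
  exact: (le_bigmax _ (fun l => abs (A i l)) l).
by rewrite exprD invfM mulrA mulfV ?mul1r // expf_neq0 // gt_eqF // prime_gt0_rat.
Qed.

(** This will show that the set of inputs with error at least 1 is a union of residue classes. *)
Lemma network_uniform dy m (N : network p_pr dy m) j : exists k, forall x y,
  padic_norm (x - y) <= p%:R ^- k ->
  padic_norm (network_eval N x - network_eval N y) <= p%:R ^- j.
Proof.
elim: N => {m} [m A b|m d A b N [k IH]]; first exact: affine_uniform.
have [l Hl] := affine_uniform A b k; exists l => x y /Hl xy /=; apply: IH.
exact: map_pReLU_nonexpansive.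
Qed.

(** The output matrix has fewer than [dy] columns, so a nonzero row vector [u] annihilates it from
    the left, leaving only the bias. *)
Lemma network_constant_form dy m (N : network p_pr dy m) :
  (m < dy)%N -> (network_width N < dy)%N ->
  exists2 u : 'rV[Qp]_dy, u != 0 & exists b, forall x, u *m network_eval N x = b.
Proof.
elim: N => {m} [m A b mdy _|m d A b N IH _].
  have : kermx A != 0.
    rewrite kermx_eq0 /row_free neq_ltn; apply/orP; left.
    exact: leq_ltn_trans (rank_leq_col A) mdy.
  case/rowV0Pn => u /sub_kermxP uA u0; exists u => //; exists (u *m b) => x /=.
  by rewrite mulmxDr mulmxA uA mul0mx add0r.
rewrite network_width_hidden gtn_max => /andP[ddy Ndy].
by have [u u0 [c uc]] := IH ddy Ndy; exists u => //; exists c => x /=.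
Qed.

(** The threshold [p^-1] rather than 1 admits [p] times a vector having an entry 1, and still makes
    [x + v] and [x] incongruent modulo [p ^ k] for [k > 1]. *)
Definition far n (v : 'cV[Zp]_n) := exists i, p%:R^-1 <= abs (padic_int_val (v i 0)).

Definition affine_on_integers n m (g : 'cV[Zp]_n -> 'cV[Qp]_m) :=
  exists D d, forall x, g x = D *m embed x + d.

(* [v1] and [v2] are translations along a direction on which some layer is not
   injective, and [u] is needed if that layer is injective on a proper coset. *)
Definition collides n m (g : 'cV[Zp]_n -> 'cV[Qp]_m) :=
  exists v1 v2 u, [/\ far v1, far v2 & forall x, exists2 y, y = x \/ y = x + u &
    g (y + v1) = g y \/ g (y + v2) = g y].

Lemma far_unit n (v : 'cV[Zp]_n) i : embed v i 0 = 1 -> far v.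
Proof.
rewrite mxE => vi; exists i; rewrite vi padic_abs1 invf_le1 ?prime_gt0_rat //.
by rewrite ltW // prime_gt1_rat.
Qed.

(** Layers are absorbed into the affine map [C x + c] as long as [pReLU] acts as the identity on the
    image of the integral points. The first layer where this fails gives a collision: either its
    linear part has a kernel, or that part is invertible and some neuron is non-integral at some
    input. *)
Lemma affine_or_collides n dy m (N : network p_pr dy m) (C : 'M[Qp]_(m, n)) c :
  (network_width N <= n)%N ->
  let g x := network_eval N (C *m embed x + c) in affine_on_integers g \/ collides g.
Proof.
elim: N C c => {m} [m A b C c _|m d A b N IH C c] /=.
  left; exists (A *m C), (A *m c + b) => x.
  by rewrite mulmxDr addrA mulmxA.
rewrite network_width_hidden geq_max => /andP[dn Nn].
pose E := A *m C; pose h := A *m c + b.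
have EE x : A *m (C *m embed x + c) + b = E *m embed x + h.
  by rewrite mulmxDr addrA mulmxA.
have -> : (fun x => network_eval N (map_mx (@pReLU p p_pr) (A *m (C *m embed x + c) + b)))
   = (fun x => network_eval N (map_mx (@pReLU p p_pr) (E *m embed x + h))).
  by apply/funext => x; rewrite EE.
have [Efree|] := boolP (row_free E^T); last first.
  rewrite -kermx_eq0 => /rowV0Pn[u /sub_kermxP uE u0]; right.
  have /rV0Pn[i0 ui0] := u0.
  have [i ui0' ui] := padic_abs_argmax ui0.
  have [v vE] : exists v : 'cV[Zp]_n, embed v = (u 0 i)^-1 *: u^T.
    apply: integral_lift => j; rewrite !mxE padic_absM padic_absV mulrC.
    by rewrite ler_pdivrMr ?mul1r ?ui // lt_def padic_abs_eq0 ui0' padic_abs_ge0.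
  have vfar : far v by apply: (@far_unit _ _ i); rewrite vE !mxE mulVf.
  exists v, v, 0; split=> // x; exists x; first by left.
  left; rewrite embedD mulmxDr vE -scalemxAr.
  have -> : E *m u^T = 0 by rewrite -[E]trmxK -trmx_mul uE trmx0.
  by rewrite scaler0 addr0.
have nd : d = n.
  by apply/eqP; rewrite eqn_leq dn; move: Efree => /eqP <-; exact: rank_leq_col.
move: A b N IH Nn E h EE Efree {dn}; rewrite nd => A b N IH Nn E h EE Efree.
have Eu : E \in unitmx by rewrite -unitmx_tr -row_free_unit.
have [allint|] := pselect (forall x : 'cV[Zp]_n, forall i, abs ((E *m embed x + h) i 0) <= 1).
  have -> : (fun x => network_eval N (map_mx (@pReLU p p_pr) (E *m embed x + h)))
    = (fun x => network_eval N (E *m embed x + h)).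
    apply/funext => x; congr network_eval; apply/matrixP => i j.
    by rewrite (ord1 j) [LHS]mxE pReLU_int.
  exact: IH E h Nn.
move=> /existsNP[x0 /existsNP[i /negP]]; rewrite -ltNge => x0i; right.
have [z zE] : exists z : 'cV[Zp]_n -> Qp, forall x, z x = (E *m embed x + h) i 0.
  by exists (fun x => (E *m embed x + h) i 0).
rewrite -zE in x0i.
have zD x v : z (x + v) = z x + (E *m embed v) i 0.
  by rewrite !zE embedD mulmxDr addrAC [in LHS]mxE.
(* The difference [u] of a point where [z] is non-integral and a point where it is integral carries
   every point where [z] is integral to one where it is not. *)
have [u uP] : exists u, forall x, exists2 y, y = x \/ y = x + u & 1 < abs (z y).
  have [alln|] := pselect (forall x, 1 < abs (z x)).
    by exists 0 => x; exists x; [left|exact: alln].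
  move=> /existsNP[x1 /negP]; rewrite -leNgt => x1i.
  exists (x0 - x1) => x; have [xi|xi] := leP (abs (z x)) 1; last by exists x; [left|exact: xi].
  exists (x + (x0 - x1)); first by right.
  rewrite zD; have := zD x1 (x0 - x1); rewrite addrC subrK => zx0.
  have -> : (E *m embed (x0 - x1)) i 0 = z x0 - z x1 by rewrite zx0 addrAC subrr add0r.
  rewrite addrCA padic_abs_dominant //; apply: le_lt_trans x0i; exact: padic_absB_le.
(* Translation along [e] changes neuron [i] only, which outputs 0 as long as it stays
   non-integral. *)
have [e Ee] : exists e : 'cV[Qp]_n, E *m e = delta_mx i 0.
  by exists (invmx E *m delta_mx i 0); rewrite mulKVmx.
have e_neq0 : e != 0.
  apply/eqP => e0; have := congr1 (fun M : 'cV[Qp]_n => M i 0) Ee; rewrite e0 mulmx0 !mxE !eqxx.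
  by move/eqP; rewrite eq_sym oner_eq0.
have [l0 el0] : exists l, e l 0 != 0.
  by have /matrix0Pn[l [j]] := e_neq0; rewrite (ord1 j); exists l.
have [l el elP] := @padic_abs_argmax _ (fun l => e l 0) _ el0.
pose t := (e l 0)^-1.
have abs_el : 0 < abs (e l 0) by rewrite lt_def padic_abs_eq0 el padic_abs_ge0.
have te k : abs (t * e k 0) <= 1.
  by rewrite padic_absM padic_absV mulrC ler_pdivrMr ?mul1r.
have [v1 v1E] : exists v : 'cV[Zp]_n, embed v = t *: e.
  by apply: integral_lift => k; rewrite mxE.
have [v2 v2E] : exists v : 'cV[Zp]_n, embed v = (p%:R * t) *: e.
  apply: integral_lift => k; rewrite mxE -mulrA padic_absM.
  by rewrite mulr_ile1 ?padic_abs_ge0 ?padic_abs_nat_le1.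
have same v s y : embed v = s *: e -> 1 < abs (z y) -> 1 < abs (z y + s) ->
    network_eval N (map_mx (@pReLU p p_pr) (E *m embed (y + v) + h)) =
    network_eval N (map_mx (@pReLU p p_pr) (E *m embed y + h)).
  move=> vE zy zys; apply: (congr1 (network_eval N)).
  apply/matrixP => k j; rewrite (ord1 j).
  rewrite [LHS]map_pReLUE.
  rewrite [RHS]map_pReLUE.
  have -> : (E *m embed (y + v) + h) k 0 = (E *m embed y + h) k 0 + s * (k == i)%:R.
    by rewrite embedD mulmxDr vE -scalemxAr Ee addrAC [LHS]mxE !mxE eqxx andbT.
  have [->|ki] := eqVneq k i; last by rewrite mulr0 addr0.
  by rewrite mulr1 -zE !pReLU_nint.
exists v1, v2, u; split.
- by apply: (@far_unit _ _ l); rewrite v1E [LHS]mxE /t mulVf.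
- exists l; have := congr1 (fun M : 'cV[Qp]_n => M l 0) v2E; rewrite !mxE => ->.
  by rewrite /t -mulrA mulVf // mulr1 padic_abs_prime.
move=> x; have [y yx zy] := uP x; exists y => //.
(* If [t] is integral, adding it keeps [z y] non-integral. Otherwise [z y + t] and [z y + p * t] are
   not both integral, since their difference has absolute value [abs t > 1]; hence the two
   translations [v1] and [v2]. *)
have [t1|t1] := leP (abs t) 1.
  left; apply: (same _ t) => //; rewrite padic_abs_dominant //; exact: le_lt_trans zy.
have [zt|zt] := ltP 1 (abs (z y + t)); first by left; apply: (same _ t).
right; apply: (same _ (p%:R * t)) => //; rewrite ltNge; apply/negP => zpt.
have := padic_absB_le zt zpt; rewrite (_ : _ - _ = t - p%:R * t); last by ring.
rewrite padic_abs_dominant ?leNgt ?t1 // padic_absN padic_absM padic_abs_prime.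
by rewrite gtr_pMl ?(lt_trans ltr01) // invf_lt1 ?prime_gt0_rat ?prime_gt1_rat.
Qed.

(* The values on distinct classes modulo [p ^ k] have distinct absolute values,
   and the values of codes [i] and [i + dy] lie on the same axis. *)
Definition witness n dy k (x : 'cV[Zp]_n) : 'cV[Qp]_dy :=
  \col_i (if (i : nat) == (code k x %% dy)%N then target p_pr k (code k x) else 0).

Lemma witness_congruent n dy k (x y : 'cV[Zp]_n) :
  congruent k x y -> witness dy k x = witness dy k y.
Proof. by rewrite /witness => /codeP ->. Qed.

Lemma witnessE n dy k (x : 'cV[Zp]_n) (i : 'I_dy) : witness dy k x i 0 =
  if (i : nat) == (code k x %% dy)%N then target p_pr k (code k x) else 0.
Proof. exact: mxE. Qed.

Lemma witness_continuous n dy k : continuous (@witness n dy k).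
Proof. exact: locally_constant_continuous (@witness_congruent n dy k). Qed.

Lemma entryB n (u v : 'cV[Qp]_n) i : (u - v) i 0 = u i 0 - v i 0.
Proof. by rewrite !mxE. Qed.

Lemma entryZ n (a : Qp) (v : 'cV[Qp]_n) i : (a *: v) i 0 = a * v i 0.
Proof. by rewrite mxE. Qed.

Lemma abs_targetB k i j : (i < j)%N ->
  abs (target p_pr k j - target p_pr k i) = p%:R ^+ (k + j.+1).
Proof.
move=> ij; rewrite padic_abs_dominant ?abs_target // padic_absN !abs_target.
by rewrite ltr_eXn2l ?prime_gt1_rat // ltn_add2l.
Qed.

(** On the axis of the point with the larger code, the other value is either 0 or of smaller
    absolute value, so the larger one dominates. *)
Lemma witness_separates n dy k (x y : 'cV[Zp]_n) : (0 < dy)%N -> ~ congruent k x y ->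
  exists i, p%:R ^+ k.+1 <= abs (witness dy k x i 0 - witness dy k y i 0).
Proof.
move=> dy0 /codeP/eqP; wlog xy : x y / (code k y < code k x)%N.
  move=> W; rewrite neq_ltn => /orP[] lt; last by apply: W; rewrite ?gtn_eqF.
  by have [|i ip] := W y x lt; [rewrite gtn_eqF|exists i; rewrite padic_dist_sym].
move=> _; exists (Ordinal (ltn_pmod (code k x) dy0)).
rewrite (@witnessE _ _ _ x) (@witnessE _ _ _ y) eqxx.
have le : p%:R ^+ k.+1 <= p%:R ^+ (k + (code k x).+1) :> rat.
  by rewrite ler_eXn2l ?prime_gt1_rat // addnS ltnS leq_addr.
by case: ifP => _; rewrite ?abs_targetB ?subr0 ?abs_target.
Qed.

Lemma far_ncongruent n k (x v : 'cV[Zp]_n) : (1 < k)%N -> far v -> ~ congruent k (x + v) x.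
Proof.
move=> k1 [i vi] /congruentP /(_ i); rewrite mxE padic_int_valD addrC addKr leNgt => /negP; apply.
apply: lt_le_trans vi; rewrite -[p%:R^-1]expr1 exprVn ltf_pV2 ?posrE ?exprn_gt0 ?prime_gt0_rat //.
by rewrite ltr_eXn2l ?prime_gt1_rat.
Qed.

(** The map [g] has equal values at the two points while the witness values are more than 1 apart,
    so one of the two errors is large. *)
Lemma error_of_collision n dy k (g : 'cV[Zp]_n -> 'cV[Qp]_dy) x v : (0 < dy)%N -> (1 < k)%N ->
  far v -> g (x + v) = g x ->
  1 <= padic_norm (witness dy k (x + v) - g (x + v)) \/ 1 <= padic_norm (witness dy k x - g x).
Proof.
move=> dy0 k1 vfar gE;
apply: contrapT => /not_orP[/negP xv1 /negP x1]; rewrite -ltNge in xv1; rewrite -ltNge in x1.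
have [i] := witness_separates dy0 (@far_ncongruent _ _ x _ k1 vfar); apply/negP; rewrite -ltNge.
rewrite -entryB.
have := padic_normD_lt xv1 (_ : padic_norm (- (witness dy k x - g x)) < 1).
rewrite padic_normN gE => /(_ x1); rewrite opprB addrA subrK => H.
apply: le_lt_trans (padic_abs_le_norm _ i) (lt_le_trans H _).
by rewrite exprn_ege1 // ltW // prime_gt1_rat.
Qed.

(** The witness is invariant under translation by [p ^ k], so small errors force [p ^ k] times the
    slope along the all-ones vector to be small. But translation by that vector itself changes the
    witness by at least [p ^ k.+1] in absolute value. *)
Lemma error_of_affine n dy k (D : 'M[Qp]_(dy, n)) d x : (0 < n)%N -> (0 < dy)%N -> (0 < k)%N ->
  exists2 v : 'cV[Zp]_n, v \in [:: 0; const_mx 1; const_mx (p ^ k)%:R] &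
    1 <= padic_norm (witness dy k (x + v) - (D *m embed (x + v) + d)).
Proof.
move=> n0 dy0 k0; apply: contrapT => /forall2NP none.
pose err z := witness dy k z - (D *m embed z + d).
have small v : v \in [:: 0; const_mx 1; const_mx (p ^ k)%:R] -> padic_norm (err (x + v)) < 1.
  by move=> vl; rewrite ltNge; apply/negP => le1; case: (none v).
have := small 0; rewrite addr0 mem_head => /(_ isT) s0.
have := small (const_mx 1); rewrite !inE eqxx orbT => /(_ isT) s1.
have := small (const_mx (p ^ k)%:R); rewrite !inE eqxx !orbT => /(_ isT) s2.
have nc : ~ congruent k (x + const_mx 1) x.
  move=> /congruentP /(_ (Ordinal n0)); rewrite !mxE padic_int_valD addrC addKr padic_int_val1
    padic_abs1 leNgt => /negP; apply.
  by rewrite invf_lt1 ?exprn_gt0 ?exprn_egt1 ?prime_gt0_rat ?prime_gt1_rat -?lt0n.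
have c : witness dy k (x + const_mx (p ^ k)%:R) = witness dy k x.
  apply: witness_congruent; apply/congruentP => i; rewrite !mxE padic_int_valD addrC addKr.
  by rewrite padic_int_val_nat natrX padic_abs_primeX.
have [i ip] := witness_separates dy0 nc.
pose P : Qp := p%:R ^+ k.
(* The linear part [D] cancels in this combination of the three errors. *)
have EP : P *: (witness dy k (x + const_mx 1) - witness dy k x) =
    P *: (err (x + const_mx 1) - err x) - (err (x + const_mx (p ^ k)%:R) - err x).
  have embP : embed (const_mx (p ^ k)%:R : 'cV[Zp]_n) = P *: embed (const_mx 1 : 'cV[Zp]_n).
    by apply/matrixP => a b; rewrite !mxE padic_int_val_nat padic_int_val1 mulr1 natrX.
  rewrite /err c !embedD embP !mulmxDr -!scalemxAr.
  apply/matrixP => a b; rewrite !mxE; ring.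
have P1 : abs P <= 1 by rewrite padic_abs_primeX prime_exp_le1.
have Plt v : padic_norm v < 1 -> padic_norm (P *: v : 'cV[Qp]_dy) < 1.
  move=> /(padic_norm_ltP _ ltr01) v1; apply/(padic_norm_ltP _ ltr01) => j; rewrite entryZ padic_absM.
  by apply: le_lt_trans (v1 j); rewrite ler_piMl ?padic_abs_ge0.
have s : padic_norm (P *: (witness dy k (x + const_mx 1) - witness dy k x)) < 1.
  rewrite EP; apply: padic_normD_lt.
    by apply: Plt; apply: padic_normD_lt; rewrite ?padic_normN.
  by rewrite padic_normN; apply: padic_normD_lt; rewrite ?padic_normN.
have := le_lt_trans (padic_abs_le_norm _ i) s; rewrite entryZ entryB padic_absM padic_abs_primeX.
rewrite ltNge => /negP; apply; rewrite -[leLHS](mulVf (prime_exp_neq0 k)) (ler_pM2l (prime_exp_gt0 p_pr k)).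
by apply: le_trans ip; rewrite (ler_eXn2l (prime_gt1_rat p_pr)).
Qed.

Definition residues n k : seq 'cV[Zp]_n :=
  [seq \col_i (t i : nat)%:R | t : {ffun 'I_n -> 'I_(p ^ k)%N}].

Lemma residuesP n k (x y : 'cV[Zp]_n) : exists2 v, v \in residues n k & congruent k (x + v) y.
Proof.
exists (\col_i (digit k (y i 0 - x i 0) : nat)%:R).
  apply/mapP; exists [ffun i => digit k (y i 0 - x i 0)]; first by rewrite mem_enum.
  by apply/matrixP => i j; rewrite !mxE ffunE.
apply/congruentP => i; rewrite !mxE padic_int_valD padic_int_val_nat.
set a := digit _ _; have := digit_near (y i 0 - x i 0) k; rewrite -/a.
rewrite padic_int_valD padic_int_valN -padic_absN; congr (_ <= _); congr abs; ring.
Qed.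

Lemma code_attained n k j : (0 < n)%N -> (j < p ^ k)%N -> exists y : 'cV[Zp]_n, code k y = j.
Proof.
case: n => // n _ jk; pose y : 'cV[Zp]_n.+1 := \col_i (if i == 0 then j%:R else 0).
have dj : digit k (j%:R : Zp) = Ordinal jk.
  by apply: digit_uniq; rewrite padic_int_val_nat subrr padic_abs0 ltW // prime_exp_gt0.
have p0 : (0 < p ^ k)%N by rewrite expn_gt0 prime_gt0.
have d0 : digit k (0%N%:R : Zp) = Ordinal p0.
  by apply: digit_uniq; rewrite padic_int_val_nat subrr padic_abs0 ltW // prime_exp_gt0.
exists y; rewrite /code big_ord_recl big1 => [|i _]; first by rewrite mxE dj expn0 muln1 addn0.
by rewrite mxE d0.
Qed.

(** Let [u 0 i] be the largest entry of [u]. If all errors were below 1, then [u 0 i] times the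
    targets of the codes [i] and [i + dy], both on axis [i], would be within [abs (u 0 i)] of [b],
    hence of each other. The bound [2 * dy <= p ^ k] makes both codes occur. *)
Lemma error_of_constant_form n dy k (g : 'cV[Zp]_n -> 'cV[Qp]_dy) (u : 'rV[Qp]_dy) b x :
  (0 < n)%N -> (2 * dy <= p ^ k)%N -> u != 0 -> (forall x, u *m g x = b) ->
  exists2 v, v \in residues n k & 1 <= padic_norm (witness dy k (x + v) - g (x + v)).
Proof.
move=> n0 dyk u0 ub; apply: contrapT => /forall2NP none.
have /rV0Pn[i0 ui0] := u0.
have [i ui uiP] := @padic_abs_argmax _ (fun i => u 0 i) _ ui0.
have abs_ui : 0 < abs (u 0 i) by rewrite lt_def padic_abs_eq0 ui padic_abs_ge0.
have key j : (j < p ^ k)%N -> (j %% dy)%N = i -> abs (u 0 i * target p_pr k j - b 0 0) < abs (u 0 i).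
  move=> jk ji; have [y yj] := code_attained n0 jk.
  have [v vl vy] := residuesP k x y.
  have lt1 : padic_norm (witness dy k (x + v) - g (x + v)) < 1.
    by rewrite ltNge; apply/negP => le1; case: (none v).
  have <- : (u *m (witness dy k (x + v) - g (x + v))) 0 0 = u 0 i * target p_pr k j - b 0 0.
    rewrite mulmxBr ub entryB; congr (_ - _).
    have /codeP Ec := vy; rewrite mxE (bigD1 i) //= big1 => [|l li].
      by rewrite witnessE Ec yj ji eqxx addr0.
    by rewrite witnessE Ec yj ji ifN ?mulr0.
  rewrite mxE; apply: padic_abs_sum_lt => // l _; rewrite padic_absM.
  apply: le_lt_trans (ler_wpM2r (padic_abs_ge0 _) (uiP l)) _.
  rewrite -[ltRHS]mulr1 ltr_pM2l //; apply: le_lt_trans lt1; exact: padic_abs_le_norm.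
have idy := ltn_ord i.
have := padic_absB_lt (key (i + dy)%N _ _) (key (i : nat) _ _).
rewrite modnDr !modn_small // => /(_ _ erefl _ erefl) H.
have : abs (u 0 i * (target p_pr k (i + dy) - target p_pr k i)) < abs (u 0 i).
  rewrite (_ : _ * _ = (u 0 i * target p_pr k (i + dy) - b 0 0) -
    (u 0 i * target p_pr k i - b 0 0)); last by ring.
  by apply: H; lia.
rewrite padic_absM gtr_pMr // abs_targetB; last by lia.
by rewrite ltNge exprn_ege1 // ltW // prime_gt1_rat.
Qed.

(** The choice of [k] gives both [1 < k] and [2 * dy <= p ^ k]. The 6 counts the sums of one of
    [0, u] and one of [0, v1, v2]; the power counts the residue classes. The bound on the size does
    not depend on [N]. *)
Lemma error_translates n dy w (N : network p_pr dy n) : let k := (2 * dy)%N in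
  (0 < n)%N -> (0 < dy)%N -> (0 < w)%N -> (w < maxn n.+1 dy)%N -> network_width N = w ->
  exists2 l : seq 'cV[Zp]_n, (size l <= 6 + (p ^ k) ^ n)%N &
    forall x, exists2 v, v \in l &
      1 <= padic_norm (witness dy k (x + v) - network_eval N (embed (x + v))).
Proof.
move=> k n0 dy0 w0 wlt Nw; have k1 : (1 < k)%N by rewrite /k; lia.
pose g x := network_eval N (embed x).
move: wlt; rewrite leq_max ltnS => /orP[wn|wdy].
  have gE : (fun x => network_eval N (1%:M *m embed x + 0)) = g.
    by apply/funext => x; rewrite mul1mx addr0.
  have Nn : (network_width N <= n)%N by rewrite Nw.
  have /= := affine_or_collides 1%:M 0 Nn; rewrite gE.
  move=> [[D [d gD]]|[v1 [v2 [u [far1 far2 gcol]]]]].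
    exists [:: 0; const_mx 1; const_mx (p ^ k)%:R] => // x.
    have [v vl v1] := error_of_affine D d x n0 dy0 (ltnW k1).
    by exists v; [exact: vl|rewrite -/(g _) gD; exact: v1].
  exists [:: 0; v1; v2; u; u + v1; u + v2]; first by rewrite leq_addr.
  move=> x; have [y yx yv] := gcol x.
  have [v vl] : exists2 v, v \in [:: 0; v1; v2] & 1 <= padic_norm (witness dy k (y + v) - g (y + v)).
    case: yv => gy.
      have [|] := error_of_collision dy0 k1 far1 gy; first by exists v1; rewrite ?inE ?eqxx ?orbT.
      by exists 0; rewrite ?inE ?eqxx ?addr0.
    have [|] := error_of_collision dy0 k1 far2 gy; first by exists v2; rewrite ?inE ?eqxx ?orbT.
    by exists 0; rewrite ?inE ?eqxx ?addr0.
  case: yx => -> err.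
    by exists v => //; move: vl; rewrite !inE => /or3P[] /eqP ->; rewrite eqxx ?orbT.
  exists (u + v); last by rewrite addrA.
  by move: vl; rewrite !inE => /or3P[] /eqP ->; rewrite ?addr0 eqxx ?orbT.
have [u u0 [b ub]] : exists2 u : 'rV[Qp]_dy, u != 0 & exists b, forall x, u *m g x = b.
  (* The input dimension may be at least [dy], so the first hidden layer is split off; it exists
     because [w] is positive. *)
  rewrite /g; move: Nw; case: {g} N => [m A b|m d A b N].
    by rewrite /network_width big_nil => w0E; rewrite -w0E in w0.
  rewrite network_width_hidden => Nw.
  have [||u u0 [c uc]] := network_constant_form (N := N).
  - by apply: leq_ltn_trans wdy; rewrite -Nw leq_maxl.
  - by apply: leq_ltn_trans wdy; rewrite -Nw leq_maxr.
  by exists u => //; exists c => x /=.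
exists (residues n k) => [|x]; first by rewrite size_map -cardE card_ffun !card_ord leq_addl.
apply: error_of_constant_form u0 ub => //.
by apply: ltnW; rewrite ltn_expl // prime_gt1.
Qed.

End Necessity.

(** * Integral norms *)

Section Integral.
Context d (T : measurableType d) (R : realType).
Local Open Scope ereal_scope.

(* Both sides are suprema of integrals of simple functions, whether or not [f]
   and [g] are measurable. *)
Lemma ge0_integral_monotone (mu : {measure set T -> \bar R}) (f g : T -> \bar R) :
  (forall x, 0 <= f x) -> (forall x, f x <= g x) ->
  \int[mu]_x f x <= \int[mu]_x g x.
Proof.
move=> f0 fg; rewrite !ge0_integralTE //; last by move=> x; exact: le_trans (fg x).
apply: le_ereal_sup => _ [h hf <-]; exists h => // x.
exact: le_trans (hf x) (fg x).
Qed.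

Lemma Lnorm_le_cst (mu : probability T R) (F : T -> \bar R) (r c : R) :
  (1 <= r)%R -> (0 <= c)%R ->
  (forall x, 0 <= F x <= c%:E) -> Lnorm mu r%:E F <= c%:E.
Proof.
move=> r1 c0 Fc; have r0 : (0 < r)%R := lt_le_trans ltr01 r1.
have cE : c%:E = (c `^ r)%:E `^ r^-1.
  by rewrite poweR_EFin -powRrM mulfV ?gt_eqF // powRr1.
rewrite unlock cE; apply: gt0_ler_poweR.
- by rewrite invr_ge0 ltW.
- by rewrite in_itv /= leey andbT integral_ge0 // => x _; exact: poweR_ge0.
- by rewrite in_itv /= leey andbT lee_fin powR_ge0.
apply: le_trans (@ge0_integral_monotone mu _ (fun=> (c `^ r)%:E) _ _) _.
- by move=> x; exact: poweR_ge0.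
- move=> x; have /andP[F0 F1] := Fc x; rewrite gee0_abs // -poweR_EFin.
  by apply: gt0_ler_poweR; rewrite ?in_itv /= ?leey ?andbT ?(ltW r0) ?lee_fin.
by rewrite integral_cst // [X in _ * X]probability_setT mule1.
Qed.

(** Chebyshev's inequality bounds the norm below by the power [1 / r] of [mu B], and this power is
    at least [mu B] because [mu B <= 1]. The resulting bound is the same for all [r]. *)
Lemma Lnorm_ge_measure (mu : probability T R) (F : T -> \bar R) (B : set T) (r : R) :
  (1 <= r)%R -> measurable B -> (forall x, 0 <= F x) -> (forall x, B x -> 1 <= F x) ->
  mu B <= Lnorm mu r%:E F.
Proof.
move=> r1 mB F0 BF; have r0 : (0 < r)%R := lt_le_trans ltr01 r1.
have le_int : mu B <= \int[mu]_x (`|F x| `^ r).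
  rewrite -[leLHS](_ : \int[mu]_x (\1_B x)%:E = _); last by rewrite integral_indic // setIT.
  apply: ge0_integral_monotone => x; first by rewrite lee_fin.
  rewrite indicE; have [|_] := boolP (x \in B); last exact: poweR_ge0.
  rewrite inE => /BF F1; rewrite gee0_abs // -(poweR1r r).
  by apply: gt0_ler_poweR; rewrite ?in_itv /= ?leey ?andbT ?(ltW r0) ?lee_fin.
have le1 : mu B <= 1 by exact: probability_le1.
rewrite unlock; apply: (@le_trans _ _ (mu B `^ r^-1)); last first.
  apply: gt0_ler_poweR le_int; rewrite ?in_itv /= ?leey ?andbT ?measure_ge0 ?invr_ge0 ?(ltW r0) //.
  by apply: integral_ge0 => x _; exact: poweR_ge0.
have Bfin : mu B \is a fin_num by exact: fin_num_measure.
rewrite -(fineK Bfin) poweR_EFin lee_fin.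
have b0 : (0 <= fine (mu B))%R by rewrite fine_ge0.
have b1 : (fine (mu B) <= 1)%R by rewrite -lee_fin fineK.
have [b_gt0|] := ltP 0%R (fine (mu B)); last first.
  by move=> b_le0; apply: le_trans b_le0 (powR_ge0 _ _).
rewrite -[leLHS]powRr1 //; apply: ger_powR; first by rewrite b_gt0.
by rewrite invf_le1.
Qed.

End Integral.

(** * Haar measure and bounds for the [L_q] norm *)

Section Haar.
Variables (p : nat) (p_pr : prime p) (R : realType) (n m : nat).
Variable mu : probability (Zpn p_pr n) R.
Local Notation Qp := (padic p_pr).
Local Notation Zp := (padic_int p_pr).

Lemma open_measurable_Zpn (A : set 'cV[Zp]_n) : open A -> measurable (A : set (Zpn p_pr n)).
Proof. by move=> oA; apply: sub_sigma_algebra. Qed.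

Lemma congruentD k (x y v : 'cV[Zp]_n) : congruent k x y -> congruent k (x + v) (y + v).
Proof.
move=> /congruentP xy; apply/congruentP => i; rewrite !mxE !padic_int_valD.
by rewrite opprD addrACA subrr addr0.
Qed.

(** The translates of [B] by the opposites of the elements of [l] cover the space and all have
    measure [mu B]; subadditivity concludes. *)
Lemma haar_cover (B : set 'cV[Zp]_n) (l : seq 'cV[Zp]_n) : is_haar mu ->
  (forall x, B x -> exists k, forall y, congruent k x y -> B y) ->
  (forall x, exists2 v, v \in l & B (x + v)) ->
  (1 <= (size l)%:R%:E * mu B)%E.
Proof.
move=> haar Bk Bl; have mB : measurable (B : set (Zpn p_pr n)).
  by apply: open_measurable_Zpn; exact: open_congruent.
pose F k : set (Zpn p_pr n) := [set (- nth 0 l k + y)%R | y in B].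
have mF k : measurable (F k).
  apply: open_measurable_Zpn; apply: open_congruent => _ [y /Bk[j yj] <-].
  exists j => z zj; exists (z + nth 0 l k); last by rewrite addrC addrK.
  by apply: yj; have := congruentD (nth 0 l k) zj; rewrite addrC addNKr.
have cover : [set: Zpn p_pr n] `<=` \big[setU/set0]_(k < size l) F k.
  move=> x _; have [v vl Bv] := Bl x; rewrite -bigcup_mkord.
  exists (index v l); first by rewrite /= index_mem.
  by exists (x + v) => //; rewrite nth_index // addrC addrK.
apply: (@le_trans _ _ (\sum_(k < size l) mu (F k))%E).
  by rewrite -(probability_setT mu); exact: content_subadditive (fun k _ => mF k) measurableT cover.
rewrite (eq_bigr (fun=> mu B)) => [|k _]; last exact: haar.
by rewrite sumr_const card_ord mule_natl.
Qed.

Lemma Lq_norm_ge (h : 'cV[Zp]_n -> 'cV[Qp]_m) (l : seq 'cV[Zp]_n) (q : \bar R) (c : R) :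
  is_haar mu -> (1 <= q)%E -> ((size l)%:R * c <= 1)%R -> (0 < c)%R ->
  (forall x, 1 <= padic_norm (h x) ->
    exists k, forall y, congruent k x y -> 1 <= padic_norm (h y)) ->
  (forall x, exists2 v, v \in l & 1 <= padic_norm (h (x + v))) ->
  (c%:E <= Lq_norm mu q h)%E.
Proof.
move=> haar q1 lc c0 hk hl; pose B := [set x | 1 <= padic_norm (h x)].
have F0 x : (0 <= (ratr (padic_norm (h x)) : R)%:E)%E.
  by rewrite lee_fin ler0q padic_norm_ge0.
have F1 x : B x -> (1 <= (ratr (padic_norm (h x)) : R)%:E)%E.
  by move=> Bx; rewrite lee_fin -(rmorph1 (@ratr R)) ler_rat.
have l0 : (0 < size l)%N by have [v] := hl 0; case: (l).
have c1 : c <= 1.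
  by apply: le_trans lc; rewrite ler_peMl ?(ltW c0) // ler1n.
rewrite /Lq_norm; case: ifPn => [_|qy].
  have [v _ Bv] := hl 0; apply: (@le_trans _ _ 1%E); first by rewrite lee_fin.
  by apply: le_trans (F1 _ Bv) _; apply: ereal_sup_ubound; exists (0 + v).
case: q q1 qy => [r|//|//] r1 _.
have mB : measurable (B : set (Zpn p_pr n)).
  by apply: open_measurable_Zpn; exact: open_congruent.
have le_mu := @Lnorm_ge_measure _ (Zpn p_pr n) R mu _ B r r1 mB F0 F1.
apply: (le_trans _ le_mu).
have := haar_cover haar hk hl; rewrite -/B.
have Bfin : mu B \is a fin_num by exact: fin_num_measure.
rewrite -(fineK Bfin) -EFinM !lee_fin => lB.
by rewrite -(ler_pM2l (x := (size l)%:R)) ?ltr0n // (le_trans lc).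
Qed.

Lemma Lq_norm_le (h : 'cV[Zp]_n -> 'cV[Qp]_m) (e : rat) (q : \bar R) : (1 <= q)%E -> 0 <= e ->
  (forall x, padic_norm (h x) <= e) -> (Lq_norm mu q h <= (ratr e)%:E)%E.
Proof.
move=> q1 e0 he; rewrite /Lq_norm; case: ifPn => [_|qy].
  by apply: ge_ereal_sup => _ [x _ <-]; rewrite lee_fin ler_rat.
case: q q1 qy => [r|//|//] r1 _; apply: Lnorm_le_cst; rewrite ?ler0q //.
by move=> x; rewrite !lee_fin ler0q padic_norm_ge0 ler_rat he.
Qed.

End Haar.

Theorem theorem1p2 (R : realType) (p : nat) (p_pr : prime p) (dx dy w : nat)
    (q : \bar R) (mu : probability (Zpn p_pr dx) R)
    (dx_gt0 : (0 < dx)%N) (dy_gt0 : (0 < dy)%N) (w_gt0 : (0 < w)%N)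
    (q_ge1 : (1%:E <= q)%E) (mu_haar : is_haar mu) :
  universal_approximation dy mu w q <-> (maxn dx.+1 dy <= w)%N.
Proof.
split=> [ua|]; last first.
  rewrite geq_max => /andP[dxw dyw] f eps fc eps0.
  (* The norm is rational-valued, so a rational tolerance below [eps] is used. *)
  have [e] := rat_in_itvoo eps0; rewrite in_itv /= ltr0q => /andP[e0 e_eps].
  have [N Nw fN] := uniform_approximation dxw (leq_ltn_trans dx_gt0 dxw) dyw fc e0.
  exists N => //; apply: le_lt_trans (Lq_norm_le mu q_ge1 (ltW e0) _) _.
    by move=> x; exact: ltW (fN x).
  by rewrite lte_fin.
rewrite leqNgt; apply/negP => wlt.
(* [K] bounds the number of translates for every network of width [w], so no such network can have
   error below [1 / K]. *)
pose k := (2 * dy)%N; pose K := (6 + (p ^ k) ^ dx)%N.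
have K0 : (0 < K%:R^-1 :> R) by rewrite invr_gt0 ltr0n.
have [N Nw] := ua (@witness p p_pr dx dy k) _ (@witness_continuous p p_pr dx dy k) K0.
have [l lK lN] := error_translates dx_gt0 dy_gt0 w_gt0 wlt Nw.
apply/negP; rewrite -leNgt; apply: (Lq_norm_ge (l := l)) => //.
  by rewrite ler_pdivrMr ?ltr0n // mul1r ler_nat.
(* Near [x] the witness is constant and the network varies by at most [p^-1 < 1], so by the
   ultrametric inequality an error of at least 1 persists. *)
move=> x x1; have [j jN] := network_uniform N 1.
exists (maxn k j) => y xy; rewrite leNgt; apply/negP => y1; move: x1; rewrite leNgt => /negP; apply.
have xyk : congruent k x y by apply: congruentW xy; exact: leq_maxl.
have /congruentP xyj : congruent j x y by apply: congruentW xy; exact: leq_maxr.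
rewrite (witness_congruent dy xyk).
set gx := network_eval N _; set gy := network_eval N (map_mx _ y) in y1.
have -> : witness dy k y - gx = (witness dy k y - gy) - (gx - gy).
  by rewrite opprB addrA subrK.
apply: padic_normD_lt => //; rewrite padic_normN.
apply: (@le_lt_trans _ _ (p%:R ^- 1)); last first.
  by rewrite expr1 invf_lt1 ?prime_gt0_rat ?prime_gt1_rat.
apply: jN; apply/padic_norm_leP => [|i]; first by rewrite ltW // prime_exp_gt0.
by have := xyj i; rewrite !mxE.
Qed.
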